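(* Let $\mathcal{M}$ be a smooth manifold with an affine connection, normal coordinates $\vartheta_\xi$ and associated operators $\boxplus,\boxminus$. Consider a system $\xi_{k+1}=F(\xi_k,u_{k+1})\boxplus\kappa_{k+1}$ on $\mathcal{M}$, state estimates $\hat\xi_{k|k}$ and $\hat\xi_{k+1|k}=F(\hat\xi_{k|k},u_{k+1})$, errors $\varepsilon_{k|k}=\xi_k\boxminus\hat\xi_{k|k}$ and $\varepsilon_{k+1|k}=\xi_{k+1}\boxminus\hat\xi_{k+1|k}$, and the noise-free propagated state $\xi^\diamond_{k+1}=F(\xi_k,u_{k+1})$. Then the linearised dynamics of $\varepsilon_{k+1|k}$ is given by $$\varepsilon_{k+1|k}=A_{k+1}\,\varepsilon_{k|k}+J_2^{-1}(\hat\xi_{k+1|k},\xi^\diamond_{k+1})\,\kappa_{k+1}+\mathbf{O}(|\varepsilon_{k|k},\kappa_{k+1}|^2),$$ where $$A_{k+1}:=\mathrm{D}\vartheta_{\hat\xi_{k+1|k}}(\hat\xi_{k+1|k})\cdot\mathrm{D}F_{u_{k+1}}(\hat\xi_{k|k})\cdot\mathrm{D}\vartheta^{-1}_{\hat\xi_{k|k}}(0).$$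
   Context: $\mathcal{M}$ is a smooth $m$-dimensional manifold with an affine connection. For $\xi\in\mathcal{M}$, $\mathrm{Exp}_\xi(v)=\gamma_v(1)$ with $\gamma_v$ the geodesic with $\gamma_v(0)=\xi$, $\dot\gamma_v(0)=v$; $W_\xi\subset\mathrm{T}_\xi\mathcal{M}$ is the largest open set on which $\mathrm{Exp}_\xi$ is a diffeomorphism onto its image; $U_\xi=\mathrm{Exp}_\xi(W_\xi)$. With a fixed locally smoothly varying family of linear isomorphisms $\imath_\xi:\mathrm{T}_\xi\mathcal{M}\to\mathbb{R}^m$, the normal coordinates are $\vartheta_\xi=\imath_\xi\circ\mathrm{Exp}_\xi^{-1}:U_\xi\to\mathbb{R}^m$. Define $\xi\boxplus u=\vartheta_\xi^{-1}(u)$ and $\zeta\boxminus\xi=\vartheta_\xi(\zeta)$ for $u\in\imath_\xi(W_\xi)$, $\zeta\in U_\xi$; all points are assumed to lie where these expressions are defined. The input $u_{k+1}$ lies in a vector space $\mathbb{L}$, $F:\mathcal{M}\times\mathbb{L}\to\mathcal{M}$ is the (smooth) system function, and $F_u(\xi):=F(\xi,u)$. The noise $\kappa_{k+1}\in\mathbb{R}^m$ is expressed in the normal coordinates around $\xi^\diamond_{k+1}=F(\xi_k,u_{k+1})$ and is distributed as a concentrated Gaussian $\mathbf{N}_{F(\xi_k,u_{k+1})}(0,Q_{k+1})$ (a density proportional to $\exp(-\frac12\kappa^\top Q_{k+1}^{-1}\kappa)$ in those coordinates). For $\zeta\in U_\xi$, $J_2^{-1}(\xi,\zeta)[w]=\frac{\mathrm{d}}{\mathrm{d}t}|_{t=0}\vartheta_\xi(\vartheta_\zeta^{-1}(tw))$,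 the inverse of $J_2(\xi,\zeta)[w]=\frac{\mathrm{d}}{\mathrm{d}t}|_{t=0}\vartheta_\xi^{-1}(\vartheta_\xi(\zeta)+tw)$ with $\mathrm{T}_\zeta\mathcal{M}\cong\mathbb{R}^m$ via $\imath_\zeta$. The notation $\mathrm{D}f(x)$ is the differential of $f$ at $x$. $\mathbf{O}(|\varepsilon_{k|k},\kappa_{k+1}|^2)$ denotes terms bounded by a constant times $|(\varepsilon_{k|k},\kappa_{k+1})|^2$ as $(\varepsilon_{k|k},\kappa_{k+1})\to0$, with $\hat\xi_{k|k}$ and $u_{k+1}$ fixed. *)

(* Defs.v *)
From HB Require Import structures.
From mathcomp Require Import all_boot all_order all_algebra.
From mathcomp Require Import all_classical all_reals all_analysis.

Set Implicit Arguments.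
Unset Strict Implicit.
Unset Printing Implicit Defensive.

Import Order.TTheory GRing.Theory Num.Theory.
Import numFieldNormedType.Exports.

Local Open Scope classical_set_scope.
Local Open Scope ring_scope.

(** * Smooth maps between normed spaces *)

(* [A] is meant to be open.  When [E] has finite dimension this is the usual
   notion of a map of class C^k, expressed with directional derivatives. *)
Fixpoint class_C {R : realType} {E G : normedModType R} (k : nat) (A : set E)
    (f : E -> G) : Prop :=
  if k is k'.+1 then
    (forall x, A x -> differentiable f x) /\
    (forall v, class_C k' A (fun x => 'd f x v))
  else forall x, A x -> {for x, continuous f}.

Definition smooth_on {R : realType} {E G : normedModType R} (A : set E)
    (f : E -> G) : Prop := forall k, class_C k A f.

(** * Smooth manifolds *)

(* A smooth atlas.  [psi i] inverts [phi i]; its values off the image of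
   [dom i] are irrelevant.  [chart_at xi] is a preferred chart around [xi]. *)
Record manifold (R : realType) (m : nat) := Manifold {
  mpoint :> topologicalType;
  mhausdorff : hausdorff_space mpoint;
  msecond_countable : @second_countable mpoint;
  mchart : Type;
  dom : mchart -> set mpoint;
  phi : mchart -> mpoint -> 'rV[R]_m;
  psi : mchart -> 'rV[R]_m -> mpoint;
  chart_at : mpoint -> mchart;
  dom_chart_at : forall xi, dom (chart_at xi) xi;
  dom_open : forall i, open (dom i);
  image_open : forall i, open (phi i @` dom i);
  phiK : forall i xi, dom i xi -> psi i (phi i xi) = xi;
  phi_continuous : forall i xi, dom i xi -> {for xi, continuous (phi i)};
  psi_continuous : forall i x, (phi i @` dom i) x -> {for x, continuous (psi i)};
  transition_smooth : forall i j,
    smooth_on (phi i @` (dom i `&` dom j)) (phi j \o psi i)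
}.

Arguments dom {R m M} : rename.
Arguments phi {R m M} : rename.
Arguments psi {R m M} : rename.
Arguments chart_at {R m M} : rename.

(* A tangent vector at [xi] is given by its components in the preferred chart
   [chart_at xi].  All tangent spaces are thus convertible, but components at
   [xi] and [zeta] refer to possibly different charts. *)
Definition tangent {R : realType} {m : nat} (M : manifold R m) (xi : M) : Type :=
  'rV[R]_m.

Section Manifold.
Context {R : realType} {m : nat} {M : manifold R m}.

(* Components in chart [i] of a tangent vector, and conversely. *)
Definition components (i : mchart M) (xi : M) (v : tangent xi) : 'rV[R]_m :=
  'd (phi i \o psi (chart_at xi)) (phi (chart_at xi) xi) v.

Definition of_components (i : mchart M) (xi : M) (w : 'rV[R]_m) : tangent xi :=
  'd (phi (chart_at xi) \o psi i) (phi i xi) w.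

(** Smoothness of maps from, to and between manifolds *)

Definition smooth_from {G : normedModType R} (U : set M) (f : M -> G) : Prop :=
  forall i, smooth_on (phi i @` (U `&` dom i)) (f \o psi i).

Definition smooth_to {E : normedModType R} (A : set E) (f : E -> M) : Prop :=
  (forall x, A x -> {for x, continuous f}) /\
  forall i, smooth_on (A `&` f @^-1` dom i) (phi i \o f).

Definition smooth_system {L : normedModType R} (F : M * L -> M) : Prop :=
  continuous F /\
  forall i j,
    smooth_on
      [set p : 'rV[R]_m * L | (phi i @` dom i) p.1 /\ dom j (F (psi i p.1, p.2))]
      (fun p : 'rV[R]_m * L => phi j (F (psi i p.1, p.2))).

(** Differentials of maps from, to and between manifolds *)

Definition diff_from {G : normedModType R} (f : M -> G) (xi : M)
    (v : tangent xi) : G :=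
  'd (f \o psi (chart_at xi)) (phi (chart_at xi) xi) v.

Definition diff_to {E : normedModType R} (f : E -> M) (x : E) (v : E) :
    tangent (f x) :=
  'd (phi (chart_at (f x)) \o f) x v.

Definition diff_self (f : M -> M) (xi : M) (v : tangent xi) : tangent (f xi) :=
  'd (phi (chart_at (f xi)) \o f \o psi (chart_at xi)) (phi (chart_at xi) xi) v.

(** Vector fields *)

Definition vfield : Type := forall xi : M, tangent xi.

Definition smooth_vfield (U : set M) (X : vfield) : Prop :=
  forall i, smooth_on (phi i @` (U `&` dom i))
    (fun x => components i (X (psi i x))).

Definition coord_vfield (i : mchart M) (a : 'I_m) : vfield :=
  fun xi => of_components i xi (delta_mx 0 a).

End Manifold.

Arguments vfield {R m} M.
Arguments diff_from {R m M G} f xi v.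
Arguments diff_to {R m M E} f x v.
Arguments diff_self {R m M} f xi v.

(** * Affine connections, geodesics and the exponential map *)

(* Since an affine connection is a local operator, it acts on smooth vector
   fields defined on any open set [U].  Here a field on [U] is the restriction
   of a possibly rough section over [M], and by [nabla_local] the result on [U]
   does not depend on that extension. *)
Record connection {R : realType} {m : nat} (M : manifold R m) := Connection {
  nabla :> vfield M -> vfield M -> vfield M;
  nabla_local : forall (U : set M) (X X' Y Y' : vfield M), open U ->
    smooth_vfield U X -> smooth_vfield U Y ->
    (forall xi, U xi -> X xi = X' xi) -> (forall xi, U xi -> Y xi = Y' xi) ->
    forall xi, U xi -> nabla X Y xi = nabla X' Y' xi;
  nabla_smooth : forall (U : set M) (X Y : vfield M), open U ->
    smooth_vfield U X -> smooth_vfield U Y -> smooth_vfield U (nabla X Y);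
  nabla_addl : forall (U : set M) (X X' Y : vfield M), open U ->
    smooth_vfield U X -> smooth_vfield U X' -> smooth_vfield U Y ->
    forall xi, U xi ->
      nabla (fun z => X z + X' z) Y xi = nabla X Y xi + nabla X' Y xi;
  nabla_scalel : forall (U : set M) (f : M -> R) (X Y : vfield M), open U ->
    smooth_from U f -> smooth_vfield U X -> smooth_vfield U Y ->
    forall xi, U xi -> nabla (fun z => f z *: X z) Y xi = f xi *: nabla X Y xi;
  nabla_addr : forall (U : set M) (X Y Y' : vfield M), open U ->
    smooth_vfield U X -> smooth_vfield U Y -> smooth_vfield U Y' ->
    forall xi, U xi ->
      nabla X (fun z => Y z + Y' z) xi = nabla X Y xi + nabla X Y' xi;
  nabla_leibniz : forall (U : set M) (f : M -> R) (X Y : vfield M), open U ->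
    smooth_from U f -> smooth_vfield U X -> smooth_vfield U Y ->
    forall xi, U xi ->
      nabla X (fun z => f z *: Y z) xi =
      diff_from f xi (X xi) *: Y xi + f xi *: nabla X Y xi
}.

Section Exponential.
Context {R : realType} {m : nat} {M : manifold R m} (D : connection M).

(* The vector of the Christoffel symbols Gamma^c_{ab}, c < m, at the point of
   coordinates [x] in chart [i]. *)
Definition christoffel (i : mchart M) (a b : 'I_m) (x : 'rV[R]_m) : 'rV[R]_m :=
  components i (D (coord_vfield i a) (coord_vfield i b) (psi i x)).

Definition geodesic (J : set R) (g : R -> M) : Prop :=
  smooth_to J g /\
  forall (i : mchart M) (t : R), J t -> dom i (g t) ->
    let c := phi i \o g in
    derive1 (derive1 c) t +
      \sum_(a < m) \sum_(b < m)
        (derive1 c t 0 a * derive1 c t 0 b) *: christoffel i a b (c t) = 0.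

(* [zeta = gamma_v(1)]. *)
Definition exp_rel (xi : M) (v : tangent xi) (zeta : M) : Prop :=
  exists (a b : R) (g : R -> M),
    [/\ a < 0, 1 < b & geodesic `]a, b[ g] /\
    [/\ g 0 = xi, derive1 (phi (chart_at xi) \o g) 0 = v & g 1 = zeta].

Definition exp_domain (xi : M) : set (tangent xi) :=
  [set v | exists zeta, exp_rel v zeta].

Definition Exp (xi : M) (v : tangent xi) : M := xget xi (exp_rel v).

Definition Exp_inv (xi : M) (W : set (tangent xi)) (zeta : M) : tangent xi :=
  xget 0 [set v | W v /\ Exp v = zeta].

Definition exp_diffeo (xi : M) (W : set (tangent xi)) : Prop :=
  [/\ W `<=` @exp_domain xi,
      {in W &, injective (@Exp xi)},
      open (@Exp xi @` W),
      smooth_to W (@Exp xi) &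
      smooth_from (@Exp xi @` W) (Exp_inv W)].

(* There is in general no greatest open set on which [Exp] is a diffeomorphism
   (on a sphere or a cylinder, unions of such sets may fail injectivity), so
   "largest" means maximal for inclusion. *)
Definition normal_domain (xi : M) (W : set (tangent xi)) : Prop :=
  [/\ open W, W 0, exp_diffeo W &
      forall W' : set (tangent xi),
        open W' -> exp_diffeo W' -> W `<=` W' -> W' = W].

End Exponential.

Arguments normal_domain {R m M} D xi W.

(** * Normal coordinates *)

Record normal_coordinates {R : realType} {m : nat} {M : manifold R m}
    (D : connection M) := NormalCoordinates {
  nc_dom : forall xi : M, set (tangent xi);
  nc_domP : forall xi : M, normal_domain D xi (@nc_dom xi);
  iota : forall xi : M, {linear tangent xi -> 'rV[R]_m};
  iota_inv : forall xi : M, 'rV[R]_m -> tangent xi;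
  iotaK : forall xi : M, cancel (iota xi) (iota_inv xi);
  iota_invK : forall xi : M, cancel (iota_inv xi) (iota xi)
}.

Arguments nc_dom {R m M D} n xi : rename.
Arguments iota {R m M D} n xi : rename.
Arguments iota_inv {R m M D} n xi : rename.

Section NormalCoordinates.
Context {R : realType} {m : nat} {M : manifold R m} {D : connection M}.
Variable N : normal_coordinates D.

(* The family [iota] is smooth on a neighbourhood of [xi0]. *)
Definition iota_locally_smooth (xi0 : M) : Prop :=
  exists O : set M, [/\ open O, O xi0 &
    forall (i : mchart M) (w : 'rV[R]_m),
      smooth_from (O `&` dom i) (fun xi : M => iota N xi (of_components i xi w))].

Definition normal_nbhd (xi : M) : set M := @Exp R m M D xi @` nc_dom N xi.

Definition normal_image (xi : M) : set 'rV[R]_m := iota N xi @` nc_dom N xi.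

Definition theta (xi zeta : M) : 'rV[R]_m :=
  iota N xi (Exp_inv D (nc_dom N xi) zeta).

Definition theta_inv (xi : M) (u : 'rV[R]_m) : M := Exp D (iota_inv N xi u).

Definition boxplus (xi : M) (u : 'rV[R]_m) : M := theta_inv xi u.

Definition boxminus (zeta xi : M) : 'rV[R]_m := theta xi zeta.

Definition J2_inv (xi zeta : M) (w : 'rV[R]_m) : 'rV[R]_m :=
  derive1 (fun t : R => theta xi (theta_inv zeta (t *: w))) 0.

End NormalCoordinates.

(** * Concentrated Gaussians *)

(* Integral over R^m with respect to Lebesgue measure, as an iterated integral;
   only used for nonnegative Borel functions. *)
Fixpoint integral_rV {R : realType} (m : nat) :
    ('rV[R]_m -> \bar R) -> \bar R :=
  if m is m'.+1 then fun f =>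
    (\int[@lebesgue_measure R]_x
        integral_rV (fun y : 'rV[R]_m' => f (row_mx (x%:M : 'rV_1) y)))%E
  else fun f => f 0.

Definition box {R : realType} {m : nat} (a b : 'rV[R]_m) : set 'rV[R]_m :=
  [set x | forall i, a 0 i <= x 0 i <= b 0 i].

Definition positive_definite {R : realType} {m : nat} (Q : 'M[R]_m) : Prop :=
  Q^T = Q /\ forall x : 'rV[R]_m, x != 0 -> 0 < (x *m Q *m x^T) 0 0.

(* [X] is the expression in the normal coordinates around [xi] of a random
   point with law N_xi(mu, Q): on the coordinate domain [normal_image N xi],
   the law of [X] has a density proportional to
   exp(-1/2 (x - mu)^T Q^-1 (x - mu)); boxes suffice to determine the law. *)
Definition concentrated_gaussian {R : realType} {m : nat} {M : manifold R m}
    {D : connection M} (N : normal_coordinates D) (xi : M) (mu : 'rV[R]_m)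
    (Q : 'M[R]_m) (d : measure_display) (T : measurableType d)
    (P : probability T R) (X : T -> 'rV[R]_m) : Prop :=
  exists c : R, 0 < c /\
    forall a b : 'rV[R]_m,
      measurable (X @^-1` box a b) /\
      P (X @^-1` box a b) =
      integral_rV (fun x =>
        (\1_(box a b `&` normal_image N xi) x * c *
         expR (- 2^-1 * ((x - mu) *m invmx Q *m (x - mu)^T) 0 0))%:E).

(* Main.v *)
(* The point xi_{k+1} is reached from zeta = F(xi_k, u) along the geodesic with
   initial velocity v = iota_zeta^-1(kappa).  No smooth dependence of geodesics
   on their initial data is needed: in a chart around xihat1 the geodesic
   equation c'' = - Gamma(c)(c', c') and a bound on Gamma near xihat1 give
   c(1) = c(0) + v + O(|v|^2), uniformly for zeta near xihat1.  Local smoothness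
   of iota makes |v| = O(|kappa|) uniformly as well.  Composing with the C^2 map
   theta_xihat1 yields
     theta_xihat1(xi_{k+1})
       = theta_xihat1(zeta) + D theta_xihat1(zeta) v + O(|kappa|^2),
   and the same estimate applied to the velocities t v shows that the linear term
   is J_2^-1(xihat1, zeta) kappa.  Finally theta_xihat1(zeta) = A eps + O(|eps|^2)
   by composing the second order expansions of the exponential map at xihat, of
   F_u and of theta_xihat1. *)
Require Import Defs.
From HB Require Import structures.
From mathcomp Require Import all_boot all_order all_algebra.
From mathcomp Require Import all_classical all_reals all_analysis.
From mathcomp Require Import ring lra.

Set Implicit Arguments.
Unset Strict Implicit.
Unset Printing Implicit Defensive.

Import Order.TTheory GRing.Theory Num.Theory.
Import numFieldNormedType.Exports.

Local Open Scope classical_set_scope.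
Local Open Scope ring_scope.

(** * Differentials and maps of class C^k *)

Section FrechetNear.
Context {R : realType} {V W : normedModType R}.

Lemma differentiable_approx (f : V -> W) x : differentiable f x ->
  forall e : R, 0 < e ->
    \forall h \near (0 : V), `|f (h + x) - f x - 'd f x h| <= e * `|h|.
Proof.
move=> /diff_locallyP [_ /eqaddoP df] e e0.
have := df e e0; apply: filterS => h /=.
by rewrite !fctE opprD addrA.
Qed.

Lemma approx_differentiable (f : V -> W) (df : {linear V -> W}) x :
  continuous df ->
  (forall e : R, 0 < e ->
    \forall h \near (0 : V), `|f (h + x) - f x - df h| <= e * `|h|) ->
  is_diff x f df.
Proof.
move=> dfc H.
have E : f \o shift x = cst (f x) + df +o_ 0 id.
  apply/eqaddoP => e e0; have := H e e0; apply: filterS => h /=.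
  by rewrite !fctE opprD addrA.
have D := diff_unique dfc E.
apply: DiffDef => //; apply/diff_locallyP; rewrite D; split => //.
Qed.

Lemma near_eq_diff (f g : V -> W) x :
  (\forall y \near x, f y = g y) -> differentiable f x -> is_diff x g ('d f x).
Proof.
move=> fg df; apply: approx_differentiable; first exact: diff_continuous.
move=> e e0; rewrite -(nbhs_singleton fg).
have fg0 : \forall h \near (0 : V), f (h + x) = g (h + x).
  by rewrite (near_shift 0 x) in fg; apply: filterS fg => h /=; rewrite subr0.
near=> h.
have <- : f (h + x) = g (h + x) by near: h.
by near: h; exact: differentiable_approx.
Unshelve. all: by end_near. Qed.

End FrechetNear.

Section MatrixNorm.
Context {R : realType} {m n : nat}.

Lemma mx_coord_le (x : 'M[R]_(m, n)) i j : `|x i j| <= `|x|.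
Proof. by rewrite [leRHS]/Num.norm /= mx_normrE (le_bigmax _ _ (i, j)). Qed.

Lemma mx_norm_le (x : 'M[R]_(m, n)) (a : R) : 0 <= a ->
  (forall i j, `|x i j| <= a) -> `|x| <= a.
Proof.
move=> a0 H; rewrite [leLHS]/Num.norm /= mx_normrE.
by apply: bigmax_le => // -[i j] _; exact: H.
Qed.

End MatrixNorm.

(** * Calculus rules for maps of class C^k *)

Section ClassC.
Context {R : realType}.
Implicit Types E G H : normedModType R.

Lemma class_CW E G k (A : set E) (f : E -> G) :
  class_C k.+1 A f -> class_C k A f.
Proof.
elim: k f => [|k IH] f [df cf]; first by move=> x /df /differentiable_continuous.
by split=> // v; exact/IH/cf.
Qed.

Lemma eq_on_diff E G (A : set E) (f g : E -> G) : open A ->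
  (forall x, A x -> f x = g x) ->
  forall x, A x -> differentiable f x -> is_diff x g ('d f x).
Proof.
move=> oA fg x Ax; apply: near_eq_diff.
by apply: filterS (open_nbhs_nbhs (conj oA Ax)) => y /fg.
Qed.

(** Openness makes the two maps agree near each point of [A], so their differentials agree there. A
    formula for a derivative that is valid only on [A] can thus be used inside the recursion of
    [class_C]. *)
Lemma class_C_eq E G k (A : set E) (f g : E -> G) : open A ->
  (forall x, A x -> f x = g x) -> class_C k A f -> class_C k A g.
Proof.
move=> oA; elim: k f g => [|k IH] f g fg /=.
  move=> cf x Ax; rewrite /prop_for /continuous_at -fg//.
  apply: cvg_trans (cf x Ax); apply: near_eq_cvg.
  by apply: filterS (open_nbhs_nbhs (conj oA Ax)) => y /fg.
move=> [df cf]; have dg x Ax := eq_on_diff oA fg Ax (df x Ax).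
split=> [x /dg[]//|v]; apply: IH (cf v) => x /dg dgx.
by rewrite diff_val.
Qed.

Lemma class_C_cst E G k (A : set E) (c : G) : class_C k A (cst c).
Proof.
elim: k c => [|k IH] c /=; first by move=> x _; exact: cvg_cst.
split=> // v; rewrite (_ : (fun _ => _) = cst 0)//.
by apply/funext => x; rewrite diff_val.
Qed.

Lemma class_CD E G k (A : set E) (f g : E -> G) : open A ->
  class_C k A f -> class_C k A g -> class_C k A (fun x => f x + g x).
Proof.
move=> oA; elim: k f g => [|k IH] f g /=.
  by move=> cf cg x Ax; apply: continuousD; [exact: cf|exact: cg].
move=> [df cf] [dg cg]; split=> [x Ax|v].
  by apply: differentiableD; [exact: df|exact: dg].
apply: (class_C_eq oA _ (IH _ _ (cf v) (cg v))) => x Ax.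
by rewrite diffD; [|exact: df|exact: dg].
Qed.

Lemma class_C_sum E G k (A : set E) n (f : 'I_n -> E -> G) : open A ->
  (forall i, class_C k A (f i)) -> class_C k A (fun x => \sum_(i < n) f i x).
Proof.
move=> oA; elim: n f => [|n IH] f cf.
  by apply: (class_C_eq oA _ (class_C_cst k A 0)) => x _; rewrite big_ord0.
have := class_CD oA (IH _ (fun i => cf (widen_ord (leqnSn n) i))) (cf ord_max).
by apply: class_C_eq => // x _; rewrite big_ord_recr.
Qed.

Lemma class_C_linear E G H k (A : set E) (l : {linear G -> H}) (f : E -> G) :
  continuous l -> open A -> class_C k A f -> class_C k A (l \o f).
Proof.
move=> cl oA; elim: k f => [|k IH] f /=.
  by move=> cf x Ax; apply: continuous_comp; [exact: cf|exact: cl].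
have dl y : differentiable l y by exact: linear_differentiable.
move=> [df cf]; split=> [x Ax|v].
  by apply: differentiable_comp; [exact: df|].
apply: (class_C_eq oA _ (IH _ (cf v))) => x Ax.
by rewrite diff_comp//=; [rewrite diff_lin|exact: df].
Qed.

Lemma scale_is_bilinear G : bilinear_for
    (GRing.Scale.Law.clone _ _ *:%R _) (GRing.Scale.Law.clone _ _ *:%R _)
    (fun (a : R) (v : G) => a *: v).
Proof.
split=> [u|u] a x y /=; first by rewrite scalerDl scalerA.
by rewrite scalerDr !scalerA mulrC.
Qed.

Lemma is_diff_scale E G (s ds : E -> R) (f df : E -> G) x :
  is_diff x s ds -> is_diff x f df ->
  is_diff x (fun y => s y *: f y) (fun v => s x *: df v + ds v *: f x).
Proof.
move=> dsx dfx.
(* Scaling is packed as a bilinear map, so that the Leibniz rule becomes the chain rule through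
   [(s y, f y)]. *)
pose B := bilinear_isBilinear.Build R R G G _ _ (fun a (v : G) => a *: v)
  (scale_is_bilinear G).
pose b : {bilinear R -> G -> G} := HB.pack (fun a (v : G) => a *: v) B.
have bc : continuous (fun p : R * G => b p.1 p.2) by exact: scale_continuous.
have -> : (fun y => s y *: f y) =
  (fun p => b p.1 p.2) \o (fun y => (s y, f y)) by [].
have db := @differentiable_bilin _ _ _ _ b (s x, f x) bc.
have dp : is_diff x (fun y => (s y, f y)) (fun v => (ds v, df v)).
  exact: is_diff_pair.
apply: DiffDef; first exact: differentiable_comp.
rewrite diff_comp// (@diff_bilin _ _ _ _ b _ bc) diff_val.
exact/funext.
Qed.

Lemma class_C_scale E G k (A : set E) (s : E -> R) (f : E -> G) : open A ->
  class_C k A s -> class_C k A f -> class_C k A (fun x => s x *: f x).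
Proof.
move=> oA; elim: k s f => [|k IH] s f.
  by move=> cs cf x Ax; apply: continuousZ; [exact: cs|exact: cf].
move=> /[dup] /class_CW cs0 [ds cs] /[dup] /class_CW cf0 [df cf].
have D x (Ax : A x) := is_diff_scale (differentiableP (ds x Ax))
  (differentiableP (df x Ax)).
split=> [x /D[]//|v].
have := class_CD oA (IH _ _ cs0 (cf v)) (IH _ _ (cs v) cf0).
by apply: class_C_eq => // x /D Dx; rewrite diff_val.
Qed.

Lemma linear_rV_sum G n (l : {linear 'rV[R]_n -> G}) v :
  l v = \sum_(i < n) v 0 i *: l (delta_mx 0 i).
Proof.
rewrite {1}(row_sum_delta v) linear_sum; apply: eq_bigr => i _.
by rewrite linearZ.
Qed.

Lemma class_C_coord E m n k (A : set E) (f : E -> 'M[R]_(m, n)) i j :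
  open A -> class_C k A f -> class_C k A (fun x => f x i j).
Proof.
move=> oA; have lin : linear (fun N : 'M[R]_(m, n) => N i j : R).
  by move=> a u w; rewrite !mxE.
pose l : {linear 'M[R]_(m, n) -> R} := HB.pack (fun N : 'M[R]_(m, n) => N i j)
  (GRing.isLinear.Build _ _ _ _ _ lin).
by apply: (@class_C_linear E _ _ k A l f) => //; exact: coord_continuous.
Qed.

(** By the chain rule the derivative is ['d g (f x)] in a direction that moves with [x]. Expanding
    this direction on the standard basis, hence the finite-dimensional middle space, leaves scalars
    times derivatives of [g] in fixed directions, to which the induction hypothesis applies. *)
Lemma class_C_comp E G n k (A : set E) (B : set 'rV[R]_n)
    (f : E -> 'rV[R]_n) (g : 'rV[R]_n -> G) :
  open A -> (forall x, A x -> B (f x)) ->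
  class_C k A f -> class_C k B g -> class_C k A (g \o f).
Proof.
move=> oA AB; elim: k g => [|k IH] g.
  move=> cf cg x Ax; apply: continuous_comp; first exact: cf.
  exact/cg/AB.
move=> /[dup] /class_CW cf0 [df cf] [dg cg]; split=> [x Ax|v].
  by apply: differentiable_comp; [exact: df|exact/dg/AB].
have := class_C_sum oA (fun i => class_C_scale oA
  (class_C_coord 0 i oA (cf v)) (IH _ cf0 (cg (delta_mx 0 i)))).
apply: class_C_eq => // x Ax /=.
by rewrite (diff_comp (df x Ax) (dg _ (AB x Ax))) /= -linear_rV_sum.
Qed.

Lemma smooth_on_comp E G n (A : set E) (B : set 'rV[R]_n)
    (f : E -> 'rV[R]_n) (g : 'rV[R]_n -> G) :
  open A -> (forall x, A x -> B (f x)) ->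
  smooth_on A f -> smooth_on B g -> smooth_on A (g \o f).
Proof. by move=> oA AB sf sg k; exact: (class_C_comp oA AB (sf k) (sg k)). Qed.

End ClassC.

(** * Mean value inequality and Taylor estimates *)

Section MeanValue.
Context {R : realType}.

Lemma near_norm_ball (E : normedModType R) (x : E) (P : E -> Prop) :
  (\forall y \near x, P y) ->
  exists2 r : R, 0 < r & forall y, `|y - x| < r -> P y.
Proof.
by move=> /nbhs_normP[r r0 rP]; exists r => // y; rewrite distrC => /rP.
Qed.

Lemma norm_ball_near (E : normedModType R) (x : E) (P : E -> Prop) (r : R) :
  0 < r -> (forall y, `|y - x| < r -> P y) -> \forall y \near x, P y.
Proof.
move=> r0 rP; apply/nbhs_normP; exists r => // y /=.
by rewrite distrC; exact: rP.
Qed.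

Lemma segment_in_ball (E : normedModType R) (z x y : E) (r t : R) :
  0 <= t <= 1 -> `|x - z| < r -> `|y - z| < r ->
  `|t *: (y - x) + x - z| < r.
Proof.
move=> /andP[t0 t1] xr yr.
have -> : t *: (y - x) + x - z = (1 - t) *: (x - z) + t *: (y - z).
  rewrite scalerBl scale1r -[RHS]addrA [- _ + _]addrC -scalerBr opprB.
  by rewrite [y - z + _]addrA subrK -addrA addrC.
rewrite (le_lt_trans (ler_normD _ _))// !normrZ !ger0_norm ?subr_ge0//.
have [->|tn0] := eqVneq t 0; first by rewrite subr0 mul1r mul0r addr0.
have tgt0 : 0 < t by rewrite lt_neqAle eq_sym tn0.
have H1 : (1 - t) * `|x - z| <= (1 - t) * r by rewrite ler_wpM2l ?subr_ge0// ltW.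
have H2 : t * `|y - z| < t * r by rewrite ltr_pM2l.
lra.
Qed.

Lemma is_derive_coord m n (c : R -> 'M[R]_(m, n)) (t : R) dc i j :
  is_derive t 1 c dc -> is_derive t 1 (fun s => c s i j) (dc i j).
Proof.
move=> [dcv dce]; have H := (derivable_mxP c t 1).1 dcv.
by apply: DeriveDef; [exact: H|rewrite -dce derive_mx// mxE].
Qed.

(** The matrix norm is the largest entry, so the scalar mean value theorem is applied to each entry;
    the intermediate points differ, but [B] bounds [dc] at all of them. *)
Lemma mean_value_le m n (c dc : R -> 'M[R]_(m, n)) (a b B : R) : a <= b ->
  (forall t, a <= t <= b -> is_derive t 1 c (dc t)) ->
  (forall t, a <= t <= b -> `|dc t| <= B) ->
  `|c b - c a| <= B * (b - a).
Proof.
move=> ab cd dB.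
have B0 : 0 <= B by rewrite (le_trans _ (dB a _)) ?lexx.
apply: mx_norm_le => [|i j]; first by rewrite mulr_ge0// subr_ge0.
have [||s sab] := @MVT_segment R (fun t => c t i j) (fun t => dc t i j) _ _ ab.
- move=> s; rewrite in_itv/= => /andP[sa sb]; apply: is_derive_coord.
  by apply: cd; rewrite !ltW.
- apply: derivable_within_continuous => s; rewrite in_itv/= => sab.
  by have [] := is_derive_coord i j (cd s sab).
rewrite in_itv /= in sab; rewrite !mxE => ->.
rewrite normrM (ger0_norm (x := b - a)) ?subr_ge0// ler_wpM2r ?subr_ge0//.
by apply: le_trans (dB s sab); exact: mx_coord_le.
Qed.

(** The mean value inequality for [t |-> f (t *: (y - x) + x) - t *: w]. Taking [w = 0] gives
    Lipschitz bounds, and [w = 'd f x (y - x)] gives Taylor remainders. *)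
Lemma segment_approx (E : normedModType R) m n (f : E -> 'M[R]_(m, n))
    (x y : E) (w : 'M[R]_(m, n)) (B : R) :
  (forall t, 0 <= t <= 1 -> differentiable f (t *: (y - x) + x)) ->
  (forall t, 0 <= t <= 1 -> `|'d f (t *: (y - x) + x) (y - x) - w| <= B) ->
  `|f y - f x - w| <= B.
Proof.
move=> df dB; pose c t := f (t *: (y - x) + x) - t *: w.
have := @mean_value_le m n c (fun t => 'd f (t *: (y - x) + x) (y - x) - w) 0 1 B.
rewrite ler01 subr0 mulr1 /c scale1r scale0r subrK scale1r scale0r add0r subr0.
rewrite addrAC; apply=> // t t01.
pose g (s : R) := s *: (y - x) + x.
have dg : is_diff t g (fun s => s *: (y - x)).
  have -> : g = (fun s => s *: (y - x)) + cst x by [].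
  have d1 : is_diff t (fun s : R => s *: (y - x)) (fun s => s *: (y - x)).
    exact: is_diff_scalel.
  by apply: is_diff_eq; apply/funext => s; rewrite /= !fctE addr0.
have dfg : is_diff t (f \o g) ('d f (g t) \o (fun s => s *: (y - x))).
  have dft : is_diff (g t) f ('d f (g t)) by apply: differentiableP; exact: df.
  exact: is_diff_comp.
have dw : is_diff t (fun s : R => s *: w) (fun s => s *: w) by exact: is_diff_scalel.
have D : is_diff t ((f \o g) - (fun s : R => s *: w))
  ('d f (g t) \o (fun s => s *: (y - x)) - (fun s => s *: w)) by exact: is_diffB.
have [Dd De] := D; apply: DeriveDef; first exact/derivable1_diffP.
by rewrite deriveE// De /= !fctE /= !scale1r.
Qed.

Lemma class_C1_bound (E : normedModType R) n (A : set 'rV[R]_n)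
    (f : 'rV[R]_n -> E) x : open A -> A x -> class_C 1 A f ->
  exists2 K : R, 0 <= K &
    \forall z \near x, A z /\ forall v, `|'d f z v| <= K * `|v|.
Proof.
move=> oA Ax [df cf].
pose e (i : 'I_n) : 'rV[R]_n := delta_mx 0 i.
exists (\sum_(i < n) (`|'d f x (e i)| + 1)).
  by apply: sumr_ge0 => i _; rewrite addr_ge0.
have Hi (i : 'I_n) : \forall z \near x, `|'d f z (e i)| <= `|'d f x (e i)| + 1.
  have /cvgrPdist_le/(_ 1 ltr01) := cf (e i) x Ax.
  apply: filterS => z; rewrite distrC -lerBlDl; apply: le_trans.
  exact: lerB_dist.
have H := filter_forall (nbhs_filter x) Hi.
have HA := open_nbhs_nbhs (conj oA Ax).
apply: filterS2 HA H => z Az Hz; split=> // v.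
rewrite [X in `|X| <= _](linear_rV_sum ('d f z) v).
apply: le_trans (ler_norm_sum _ _ _) _.
rewrite [leRHS]mulr_suml.
apply: ler_sum => i _; rewrite normrZ [leLHS]mulrC.
by apply: (ler_pM _ _ (Hz i) (mx_coord_le v 0 i)); exact: normr_ge0.
Qed.

Lemma class_C1_lipschitz m n p (A : set 'rV[R]_p)
    (f : 'rV[R]_p -> 'M[R]_(m, n)) x : open A -> A x -> class_C 1 A f ->
  exists2 K : R, 0 <= K & exists2 r : R, 0 < r &
    forall y z, `|y - x| < r -> `|z - x| < r -> `|f z - f y| <= K * `|z - y|.
Proof.
move=> oA Ax cf; have [K K0 /near_norm_ball[r r0 rK]] := class_C1_bound oA Ax cf.
exists K => //; exists r => // y z yr zr; rewrite -[_ - f y]subr0.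
have s t t01 := rK _ (@segment_in_ball _ x y z r t t01 yr zr).
apply: segment_approx => t /s[Az]; first by move=> _; exact: cf.1.
by move=> /(_ (z - y)); rewrite subr0.
Qed.

(** The partial derivatives are C^1, hence Lipschitz near [x], which makes the remainder along a
    segment quadratic. Both endpoints vary in the ball because expansions are later needed at the
    moving point [F (xi, u)]. *)
Lemma class_C2_taylor m n p (A : set 'rV[R]_p)
    (f : 'rV[R]_p -> 'M[R]_(m, n)) x : open A -> A x -> class_C 2 A f ->
  exists2 K : R, 0 <= K & exists2 r : R, 0 < r &
    forall y z, `|y - x| < r -> `|z - x| < r ->
      [/\ A y, forall v, `|'d f y v| <= K * `|v| &
      `|f z - f y - 'd f y (z - y)| <= K * `|z - y| ^+ 2].
Proof.
move=> oA Ax cf.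
have [K0 K00 /near_norm_ball[r0 r00 rK0]] := class_C1_bound oA Ax (class_CW cf).
pose e (i : 'I_p) : 'rV[R]_p := delta_mx 0 i.
(* The bound is stated for all small [r > 0], so that intersecting finitely many filter sets yields
   one radius for all basis directions. *)
have H (i : 'I_p) : exists K : R, 0 <= K /\ \forall r \near (0 : R)^'+,
    forall y z, `|y - x| < r -> `|z - x| < r ->
      `|'d f z (e i) - 'd f y (e i)| <= K * `|z - y|.
  have [K K_ge0 [r r_gt0 rK]] := class_C1_lipschitz oA Ax (cf.2 (e i)).
  exists K; split=> //; apply: filterS (nbhs_right_lt r_gt0) => s sr y z ys zs.
  by apply: rK; [exact: lt_trans sr|exact: lt_trans sr].
have [k /all_and2[k0 kP]] := choice H.
have kP' : \forall r \near (0 : R)^'+, forall i : 'I_p,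
    forall y z, `|y - x| < r -> `|z - x| < r ->
      `|'d f z (e i) - 'd f y (e i)| <= k i * `|z - y|.
  exact: filter_forall kP.
have [r [rk r_gt0 rr0]] : exists r, [/\ forall i : 'I_p,
    forall y z, `|y - x| < r -> `|z - x| < r ->
      `|'d f z (e i) - 'd f y (e i)| <= k i * `|z - y|, 0 < r & r < r0].
  have rP := nbhs_right_gt (0 : R); have rQ := nbhs_right_lt r00.
  by have [r [? []]] := filter_ex (filterI kP' (filterI rP rQ)); exists r.
have S0 : 0 <= \sum_(i < p) k i by exact: sumr_ge0.
exists (K0 + \sum_(i < p) k i); first exact: addr_ge0.
exists r => // y z yr zr.
have [Ay dy] := rK0 y (lt_trans yr rr0); split=> // [v|].
  by rewrite (le_trans (dy v))// ler_wpM2r// lerDl.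
apply: segment_approx => t t01.
  have [+ _] := rK0 _ (lt_trans (segment_in_ball t01 yr zr) rr0).
  exact: cf.1.
rewrite [X in `|X - _| <= _](linear_rV_sum ('d f (t *: (z - y) + y)) (z - y)).
rewrite [X in `|_ - X| <= _](linear_rV_sum ('d f y) (z - y)) -sumrB.
rewrite (le_trans (ler_norm_sum _ _ _))//.
rewrite mulrDl ler_wpDl ?mulr_ge0// mulr_suml; apply: ler_sum => i _.
rewrite -scalerBr normrZ expr2 mulrA [leLHS]mulrC.
apply: (ler_pM _ _ _ (mx_coord_le _ 0 i)); [exact: normr_ge0|exact: normr_ge0|].
apply: le_trans (rk i _ _ yr (segment_in_ball t01 yr zr)) _.
rewrite addrK normrZ ler_wpM2l// ler_piMl//.
by case/andP: t01 => t0 t1; rewrite ger0_norm.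
Qed.

End MeanValue.

(** * Quadratic remainders and their propagation *)

Section Quadratic.
Context {R : realType}.

Lemma quadratic_diff (V W : normedModType R) (f : V -> W) (df : {linear V -> W})
    x (C : R) : continuous df ->
  (\forall h \near (0 : V), `|f (h + x) - f x - df h| <= C * `|h| ^+ 2) ->
  is_diff x f df.
Proof.
move=> cdf H; apply: approx_differentiable => // e e0.
pose C' := `|C| + 1; have C'0 : 0 < C' by rewrite ltr_wpDl.
have ec : 0 < e / C' by rewrite divr_gt0.
have He : \forall h \near (0 : V), `|h| <= e / C'.
  by apply: (@norm_ball_near _ _ _ _ _ ec) => h; rewrite subr0 => /ltW.
apply: filterS2 H He => h Hh he; apply: (le_trans Hh).
rewrite expr2 mulrA; apply: ler_wpM2r => //.
have CC : C <= C' by rewrite (le_trans (ler_norm C))// lerDl.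
apply: (le_trans (ler_wpM2r (normr_ge0 h) CC)).
by rewrite mulrC -ler_pdivlMr.
Qed.

Lemma quadratic_derive1 (W : normedModType R) (f : R -> W) (w : W) (C : R) :
  (\forall h \near (0 : R), `|f h - f 0 - h *: w| <= C * `|h| ^+ 2) ->
  derive1 f 0 = w.
Proof.
move=> H; have lin : linear (fun h : R => h *: w).
  by move=> a b c; rewrite scalerDl scalerA.
pose l : {linear R -> W} := HB.pack (fun h : R => h *: w)
  (GRing.isLinear.Build _ _ _ _ _ lin).
have [df e] : is_diff (0 : R) f l.
  apply: (@quadratic_diff _ _ _ _ _ C); first exact: scalel_continuous.
  by apply: filterS H => h; rewrite addr0.
by rewrite derive1E deriveE// e /= scale1r.
Qed.

Lemma linear_rV_bound (W : normedModType R) n (l : {linear 'rV[R]_n -> W}) :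
  exists2 K : R, 0 < K & forall v, `|l v| <= K * `|v|.
Proof.
have S0 : 0 <= \sum_(i < n) `|l (delta_mx 0 i)| by exact: sumr_ge0.
exists (\sum_(i < n) `|l (delta_mx 0 i)| + 1) => [|v]; first by rewrite ltr_wpDl.
rewrite mulrDl mul1r ler_wpDr// [X in `|X| <= _](linear_rV_sum l v) mulr_suml.
apply: le_trans (ler_norm_sum _ _ _) _; apply: ler_sum => i _.
by rewrite normrZ [leLHS]mulrC; apply: ler_wpM2l => //; exact: mx_coord_le.
Qed.

Lemma bound_linear_continuous (V W : normedModType R) (l : {linear V -> W})
    (K : R) : 0 < K -> (forall v, `|l v| <= K * `|v|) -> continuous l.
Proof.
move=> K0 lK x; apply/(@cvgrPdist_lt _ _ _ (nbhs x)) => e e0.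
have ek : 0 < e / K by rewrite divr_gt0.
apply: (@norm_ball_near _ _ _ _ _ ek) => y; rewrite distrC => xy.
by rewrite -linearB (le_lt_trans (lK _))// mulrC -ltr_pdivlMr.
Qed.

Lemma linear_rV_continuous (W : normedModType R) n (l : {linear 'rV[R]_n -> W}) :
  continuous l.
Proof.
have [K K0 lK] := linear_rV_bound l.
exact: bound_linear_continuous K0 lK.
Qed.

(** Meant for chaining: hypothesis and conclusion have the same shape, a displacement equal to a
    linear term up to [O(s^2)], so successive maps can be expanded one after the other. Taylor's
    formula handles [z - y], and the bound on ['d f y] handles the error [z - y - w]. *)
Lemma taylor_perturbation n p (A : set 'rV[R]_p) (f : 'rV[R]_p -> 'rV[R]_n) x
    (C : R) : open A -> A x -> class_C 2 A f -> 0 <= C ->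
  exists2 K : R, 0 < K & exists2 r : R, 0 < r &
    forall y z w s, `|y - x| < r -> s < r -> `|w| <= s ->
      `|z - y - w| <= C * s ^+ 2 ->
      [/\ A z, `|'d f y w| <= K * s & `|f z - f y - 'd f y w| <= K * s ^+ 2].
Proof.
move=> oA Ax cf C0; have [K K0 [r r0 rK]] := class_C2_taylor oA Ax cf.
pose d := 2 + C; have d0 : 0 < d by rewrite /d; lra.
(* [K * (1 + C) ^+ 2] comes from the Taylor remainder, as [z - y] has norm at most [(1 + C) * s];
   [K * C] comes from ['d f y (z - y - w)]; [K] bounds ['d f y w], and 1 gives positivity. *)
exists (K * ((1 + C) ^+ 2 + C) + K + 1).
  by rewrite ltr_wpDl// addr_ge0// mulr_ge0// addr_ge0// sqr_ge0.
(* With [d = 2 + C] both [y - x] and [z - y] have norm below [r / 2]; [s < 1] gives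
   [s ^+ 2 <= s]. *)
exists (Num.min (r / (2 * d)) 1).
  by rewrite lt_min ltr01 andbT divr_gt0// mulr_gt0.
move=> y z w s; rewrite !lt_min => /andP[yr _] /andP[sr s1] ws zyw.
have s0 : 0 <= s by exact: le_trans ws.
have ss : s ^+ 2 <= s by rewrite expr2 ler_piMl// ltW.
have rd : r / (2 * d) * d = r / 2 by field; rewrite gt_eqF.
have rdr : r / (2 * d) <= r / 2.
  by rewrite -rd ler_peMr ?divr_ge0 ?mulr_ge0 ?ltW// /d; lra.
have zy : `|z - y| <= (1 + C) * s.
  rewrite -(subrK w (z - y)); apply: le_trans (ler_normD _ _) _.
  apply: le_trans (lerD zyw ws) _.
  by rewrite addrC mulrDl mul1r lerD2l ler_wpM2l.
have sd : s * d < r / 2 by rewrite -rd ltr_pM2r.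
have yr' : `|y - x| < r by apply: lt_le_trans yr _; apply: le_trans rdr _; lra.
have zr : `|z - x| < r.
  rewrite -(subrKA y); apply: le_lt_trans (ler_normD _ _) _.
  have h1 : (1 + C) * s <= s * d.
    by rewrite mulrC ler_wpM2l// /d; lra.
  apply: lt_le_trans (ler_ltD zy (lt_le_trans yr rdr)) _.
  by clear -h1 sd; lra.
have [Az _ _] := rK _ _ zr zr.
have [_ dfy fzy] := rK _ _ yr' zr.
have H1 : K * s <= (K * ((1 + C) ^+ 2 + C) + K + 1) * s.
  apply: ler_wpM2r => //; have : 0 <= K * ((1 + C) ^+ 2 + C).
    by rewrite mulr_ge0// addr_ge0// sqr_ge0.
  by clear; lra.
split=> //.
  by apply: le_trans (dfy _) _; apply: le_trans (ler_wpM2l K0 ws) _.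
have -> : f z - f y - 'd f y w = (f z - f y - 'd f y (z - y)) + 'd f y (z - y - w).
  by rewrite [X in _ = _ + X](linearB ('d f y) (z - y) w) addrA subrK.
apply: le_trans (ler_normD _ _) _.
apply: le_trans (lerD fzy (dfy _)) _.
have H2 : K * `|z - y| ^+ 2 <= K * ((1 + C) ^+ 2 * s ^+ 2).
  apply: ler_wpM2l => //; rewrite -exprMn !expr2.
  by apply: ler_pM.
have H3 := ler_wpM2l K0 zyw.
apply: le_trans (lerD H2 H3) _.
rewrite -mulrDr -mulrDl mulrA; apply: ler_wpM2r; first exact: sqr_ge0.
by clear -K0; lra.
Qed.
End Quadratic.

(** * Charts *)

Lemma open_preimage_on (S T : topologicalType) (A : set S) (B : set T)
    (f : S -> T) : open A -> open B -> (forall x, A x -> {for x, continuous f}) ->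
  open (A `&` f @^-1` B).
Proof.
move=> oA oB cf; rewrite openE => x [Ax Bfx]; apply: filterI.
  exact: open_nbhs_nbhs.
by apply: (cf x Ax); exact: open_nbhs_nbhs.
Qed.

(** The middle space is the product [E * L], outside the scope of [class_C_comp]. The inclusion of
    the slice is affine, so the derivative in direction [v] is that of [f] in the fixed direction
    [(v, 0)], and the induction stays inside slices. *)
Lemma class_C_slice {R : realType} (E L G : normedModType R) k (A : set (E * L))
    (f : E * L -> G) (u : L) : open A -> class_C k A f ->
  class_C k [set x | A (x, u)] (fun x => f (x, u)).
Proof.
move=> oA.
have ds (x : E) : is_diff x (fun y : E => (y, u)) (fun v : E => (v, 0 : L)).
  exact: is_diff_pair (is_diff_id x) (is_diff_cst u x).
have cs (x : E) : {for x, continuous (fun y : E => (y, u))}.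
  by apply: differentiable_continuous; have [] := ds x.
have oS : open [set x | A (x, u)].
  by rewrite -[X in open X]setTI; apply: open_preimage_on => //; exact: openT.
elim: k f => [|k IH] f.
  move=> cf x Ax; have := @continuous_comp _ _ _ (fun y : E => (y, u)) f x.
  by apply=> //; exact: cf.
move=> [df cf].
have D x : A (x, u) -> 'd (fun y : E => f (y, u)) x =
    (fun v => 'd f (x, u) (v, 0)) :> (E -> G).
  move=> Ax; have [dsx e] := ds x.
  by have := diff_comp dsx (df _ Ax); rewrite e.
split=> [x Ax|v].
  have [dsx _] := ds x.
  exact: (@differentiable_comp _ _ _ _ (fun y : E => (y, u)) f _ dsx (df _ Ax)).
by apply: (class_C_eq oS _ (IH _ (cf (v, 0)))) => x Ax; rewrite D.
Qed.

(** The chain rule for composites that simplify only on an open set, as when [psi i] and [phi i]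
    cancel inside a chart. The base point of [g] is a separate [y], so that [f x] may be simplified
    too. *)
Lemma diff_comp_eq {R : realType} (E F G : normedModType R) (A : set E)
    (f : E -> F) (g : F -> G) (h : E -> G) x y : open A -> A x ->
  (forall z, A z -> g (f z) = h z) -> f x = y ->
  differentiable f x -> differentiable g y ->
  differentiable h x /\ forall v, 'd h x v = 'd g y ('d f x v).
Proof.
move=> oA Ax gf <- df dg.
have dgf : differentiable (g \o f) x by exact: differentiable_comp.
have [dh e] := eq_on_diff oA gf Ax dgf.
by split=> // v; rewrite e diff_comp.
Qed.

Section Charts.
Context {R : realType} {m : nat} {M : manifold R m}.
Implicit Types (i j k : mchart M) (xi : M) (v w : 'rV[R]_m).

Lemma phi_image_setI i (U : set M) :
  phi i @` (U `&` dom i) = phi i @` dom i `&` psi i @^-1` U.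
Proof.
apply/seteqP; split => [_ [z [Uz iz] <-]|_ [[z iz <-]] /=].
  by split; [exists z|rewrite /= phiK].
by rewrite phiK// => Uz; exists z.
Qed.

Lemma phi_image_open i (U : set M) : open U -> open (phi i @` (U `&` dom i)).
Proof.
move=> oU; rewrite phi_image_setI; apply: open_preimage_on => //.
  exact: image_open.
exact: psi_continuous.
Qed.

Lemma transition_differentiable i j xi : dom i xi -> dom j xi ->
  differentiable (phi j \o psi i) (phi i xi).
Proof.
by move=> ix jx; have [+ _] := @transition_smooth _ _ M i j 1; apply; exists xi.
Qed.

Lemma transition_comp i j k xi v : dom i xi -> dom j xi -> dom k xi ->
  'd (phi k \o psi j) (phi j xi) ('d (phi j \o psi i) (phi i xi) v) =
  'd (phi k \o psi i) (phi i xi) v.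
Proof.
move=> ix jx kx; have dij := transition_differentiable ix jx.
have djk := transition_differentiable jx kx.
have oA := phi_image_open (i := i) (dom_open j).
have Ax : (phi i @` (dom j `&` dom i)) (phi i xi) by exists xi.
have gf z : (phi i @` (dom j `&` dom i)) z ->
    (phi k \o psi j) ((phi j \o psi i) z) = (phi k \o psi i) z.
  by move=> [w [jw iw] <-] /=; rewrite !phiK.
have fx : (phi j \o psi i) (phi i xi) = phi j xi by rewrite /= phiK.
have [_ e] := diff_comp_eq oA Ax gf fx dij djk.
exact: esym (e v).
Qed.

Lemma transition_id i xi v : dom i xi ->
  'd (phi i \o psi i) (phi i xi) v = v.
Proof.
move=> ix; have oA := @image_open _ _ M i.
have Ax : (phi i @` dom i) (phi i xi) by exists xi.
have [_ E] : is_diff (phi i xi) (phi i \o psi i) ('d idfun (phi i xi)).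
  by apply: (eq_on_diff oA _ Ax) => // _ [z iz <-] /=; rewrite phiK.
exact: etrans (congr1 (@^~ v) E) (congr1 (@^~ v) (diff_val (f := idfun))).
Qed.

Lemma of_componentsK i xi w : dom i xi ->
  components i (@of_components _ _ M i xi w) = w.
Proof.
move=> ix; rewrite /components /of_components transition_comp// ?transition_id//.
exact: dom_chart_at.
Qed.

Lemma componentsK i xi (v : tangent xi) : dom i xi ->
  of_components i xi (components i v) = v.
Proof.
move=> ix; rewrite /components /of_components.
have cx := dom_chart_at xi; rewrite transition_comp//.
exact: transition_id.
Qed.

(** In chart [j] the components are the derivative of [phi j \o psi i] along a fixed basis vector,
    composed with [phi i \o psi j]. The preferred chart, which may jump with the point, cancels by
    [transition_comp]. *)
Lemma coord_vfield_smooth i (a : 'I_m) : smooth_vfield (dom i) (coord_vfield i a).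
Proof.
move=> j; have oA := phi_image_open (i := j) (dom_open i).
have oB := phi_image_open (i := i) (dom_open j).
have tij : smooth_on (phi i @` (dom j `&` dom i))
    (fun y => 'd (phi j \o psi i) y (delta_mx 0 a)).
  move=> k; rewrite setIC; have [_] := @transition_smooth _ _ M i j k.+1.
  exact.
have tji : smooth_on (phi j @` (dom i `&` dom j)) (phi i \o psi j).
  by rewrite setIC; exact: transition_smooth.
have sm := smooth_on_comp oA _ tji tij.
move=> k; apply: class_C_eq oA _ (sm _ k) => [_ [z [iz jz] <-]|_ [z [iz jz] <-]].
  rewrite /coord_vfield /components /of_components /= phiK//.
  exact: esym (transition_comp _ iz (dom_chart_at z) jz).
by exists z => //=; rewrite phiK.
Qed.

Lemma christoffel_continuous (D : connection M) i (a b : 'I_m) x :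
  (phi i @` dom i) x -> {for x, continuous (christoffel D i a b)}.
Proof.
have := @nabla_smooth _ _ _ D (dom i) _ _ (dom_open i)
  (@coord_vfield_smooth i a) (@coord_vfield_smooth i b) i 0%N.
by rewrite setIid; exact.
Qed.
End Charts.

(** * Geodesics *)

Section Geodesics.
Context {R : realType}.

(** The supremum of the [t] such that [P] holds on [[0, t]] satisfies [P] by the limit hypothesis;
    were it below 1, the openness hypothesis would exceed it. *)
Lemma real_induction (P : R -> Prop) :
  P 0 ->
  (forall t, 0 < t <= 1 -> (forall s, 0 <= s < t -> P s) -> P t) ->
  (forall t, 0 <= t < 1 -> (forall s, 0 <= s <= t -> P s) ->
    \forall s \near t, P s) ->
  forall t, 0 <= t <= 1 -> P t.
Proof.
move=> P0 Plim Pnext.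
pose S := [set t : R | 0 <= t <= 1 /\ forall s, 0 <= s <= t -> P s].
have S0 : S 0.
  split=> [|s]; first by rewrite lexx ler01.
  by move=> s0; have -> : s = 0 by apply/eqP; rewrite eq_le andbC.
have uS : ubound S 1 by move=> t [/andP[]].
have hS : has_sup S by split; [exists 0|exists 1].
have sup0 : 0 <= sup S by apply: ub_le_sup => //; exists 1.
have sup1 : sup S <= 1 by apply: ge_sup => //; exists 0.
have Plt s : 0 <= s < sup S -> P s.
  move=> /andP[s0 ss]; have [t [_ Pt] st] := sup_gt hS.1 ss.
  by apply: Pt; rewrite s0 ltW.
have Psup s : 0 <= s <= sup S -> P s.
  move=> /andP[s0]; rewrite le_eqVlt => /orP[/eqP->|ss]; last first.
    by apply: Plt; rewrite s0.
  have [->//|sn0] := eqVneq (sup S) 0.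
  by apply: Plim => //; rewrite sup1 lt_neqAle eq_sym sn0 sup0.
suff -> : 1 = sup S by [].
apply/eqP; rewrite eq_le sup1 andbT leNgt; apply/negP => s1.
have sS : 0 <= sup S < 1 by rewrite sup0.
have /near_norm_ball[e e0 Pe] := Pnext _ sS Psup.
pose u := Num.min (sup S + e / 2) 1.
have su : sup S < u by rewrite lt_min s1 andbT ltrDl divr_gt0.
suff /(ub_le_sup hS.2) : S u by rewrite leNgt su.
split=> [|s /andP[s0 su']]; first by rewrite (le_trans sup0 (ltW su)) ge_min lexx orbT.
have [ss|ss] := leP s (sup S); first by apply: Psup; rewrite s0.
apply: Pe; rewrite ger0_norm ?subr_ge0 1?ltW//.
have : s <= sup S + e / 2 by rewrite (le_trans su')// ge_min lexx.
lra.
Qed.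

Context {m : nat} {M : manifold R m} (D : connection M).

Lemma christoffel_bound (i : mchart M) x : (phi i @` dom i) x ->
  exists2 K : R, 0 < K & exists2 rho : R, 0 < rho &
    forall y, `|y - x| <= rho -> (phi i @` dom i) y /\
      forall p : 'rV[R]_m, `|\sum_(a < m) \sum_(b < m)
        (p 0 a * p 0 b) *: christoffel D i a b y| <= K * `|p| ^+ 2.
Proof.
move=> ix.
pose k a b : R := `|christoffel D i a b x| + 1.
pose K : R := \sum_(a < m) \sum_(b < m) k a b.
have K0 : 0 <= K.
  by apply: sumr_ge0 => a _; apply: sumr_ge0 => b _; rewrite addr_ge0.
have Hab (a b : 'I_m) : \forall y \near x, `|christoffel D i a b y| <= k a b.
  have /cvgrPdist_le/(_ 1 ltr01) :=
    christoffel_continuous (D := D) (a := a) (b := b) ix.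
  apply: filterS => z; rewrite distrC -lerBlDl; apply: le_trans.
  exact: lerB_dist.
have H : \forall y \near x, forall a b : 'I_m, `|christoffel D i a b y| <= k a b.
  have Ha (a : 'I_m) := filter_forall (nbhs_filter x) (Hab a).
  exact: filter_forall (nbhs_filter x) Ha.
have oi := open_nbhs_nbhs (conj (@image_open _ _ M i) ix).
have /near_norm_ball[r r0 rP] : \forall y \near x,
    (forall a b : 'I_m, `|christoffel D i a b y| <= k a b) /\ (phi i @` dom i) y.
  exact: filterI.
exists (K + 1); first by rewrite ltr_wpDl.
(* Halving the radius passes from an open to a closed ball, whose compactness is used later. *)
exists (r / 2) => [|y yr]; first by rewrite divr_gt0.
have [|Hy iy] := rP y; first by rewrite (le_lt_trans yr)//; lra.
split=> // p; rewrite mulrDl ler_wpDr ?mulr_ge0// ?exprn_ge0// mulr_suml.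
apply: le_trans (ler_norm_sum _ _ _) _; apply: ler_sum => a _.
rewrite mulr_suml; apply: le_trans (ler_norm_sum _ _ _) _; apply: ler_sum => b _.
rewrite normrZ [leLHS]mulrC; apply: (ler_pM _ _ (Hy a b)) => //.
by rewrite normrM expr2; apply: ler_pM => //; exact: mx_coord_le.
Qed.

Lemma geodesic_chart (a b : R) (g : R -> M) (i : mchart M) (t : R) :
  geodesic D `]a, b[ g -> a < t < b -> dom i (g t) ->
  [/\ \forall s \near t, a < s < b /\ dom i (g s),
    is_derive t 1 (phi i \o g) (derive1 (phi i \o g) t) &
    is_derive t 1 (derive1 (phi i \o g)) (derive1 (derive1 (phi i \o g)) t)].
Proof.
move=> [[gc gs] _] tab gt.
pose A := `]a, b[%classic `&` g @^-1` dom i.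
have oA : open A.
  by apply: open_preimage_on => //; exact: dom_open.
have Jt : `]a, b[%classic t by rewrite /= in_itv.
have At : A t by [].
have nA := open_nbhs_nbhs (conj oA At).
have [dc ddc] := gs i 2.
have dct := dc t At.
have [ddct _] := ddc 1; have {}ddct := ddct t At.
split.
- by apply: filterS nA => s []; rewrite /= in_itv.
- by apply: DeriveDef; [exact/derivable1_diffP|rewrite derive1E].
- have E s : A s -> 'd (phi i \o g) s 1 = derive1 (phi i \o g) s.
    by move=> /dc dcs; rewrite derive1E'.
  have [+ _] := eq_on_diff oA E At ddct.
  move=> d; apply: DeriveDef; last exact: esym (derive1E _ _).
  exact: (derivable1_diffP _ _).2 d.
Qed.

End Geodesics.

(** * A priori estimate for geodesics of small initial velocity *)

Section GeodesicEstimate.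
Context {R : realType}.

Lemma closed_left_limit (T : topologicalType) (f : R -> T) (C : set T) (t : R) :
  closed C -> {for t, continuous f} -> 0 < t ->
  (forall s, 0 <= s < t -> C (f s)) -> C (f t).
Proof.
move=> cC ft t0 Cs; apply: cC => B /ft /near_norm_ball[e e0 eB].
pose s := Num.max 0 (t - e / 2).
have s0 : 0 <= s by rewrite le_max lexx.
have st : s < t by rewrite gt_max t0 /=; lra.
have se : t - e / 2 <= s by rewrite le_max lexx orbT.
exists (f s); split; first by apply: Cs; rewrite s0.
by apply: eB; rewrite distrC ger0_norm ?subr_ge0 1?ltW//; lra.
Qed.

Context {m : nat} {M : manifold R m} (D : connection M).

Lemma closed_chart_ball (i : mchart M) (x : 'rV[R]_m) (rho : R) : 0 < rho ->
  (forall y, `|y - x| <= rho -> (phi i @` dom i) y) ->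
  closed (psi i @` [set y | `|y - x| <= rho]).
Proof.
move=> rho0 rhoi; apply: compact_closed; first exact: mhausdorff.
apply: continuous_compact.
  by apply: continuous_in_subspaceT => y; rewrite inE => /rhoi; exact: psi_continuous.
have cb : [set y | `|y - x| <= rho] = closed_ball x rho.
  by rewrite closed_ballE//; apply/seteqP; split=> y /=; rewrite distrC.
apply: bounded_closed_compact; last by rewrite cb; exact: closed_ball_closed.
exists (rho + `|x|); split=> [|N rN y /= yx]; first exact: num_real.
rewrite (le_trans _ (ltW rN))// -[y](subrK x) (le_trans (ler_normD _ _))//.
by rewrite lerD2r.
Qed.

(* Bootstrap on [P t]: the geodesic is still in the chart ball of radius [rho]
   and has speed at most [2 * r].  Both conditions are closed: the image of the
   compact ball is closed because [M] is Hausdorff, so the geodesic cannot leave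
   the chart in the limit.  Integrating the geodesic equation twice makes both
   inequalities strict, hence they persist. *)
Lemma geodesic_estimate (i : mchart M) (x : 'rV[R]_m) (K rho : R) :
  0 < K -> 0 < rho ->
  (forall y, `|y - x| <= rho -> (phi i @` dom i) y /\
    forall p : 'rV[R]_m, `|\sum_(a < m) \sum_(b < m)
      (p 0 a * p 0 b) *: christoffel D i a b y| <= K * `|p| ^+ 2) ->
  forall (a b r : R) (g : R -> M), a < 0 -> 1 < b -> geodesic D `]a, b[ g ->
  dom i (g 0) -> `|phi i (g 0) - x| < rho / 2 ->
  0 < r -> 4 * K * r < 1 -> 4 * r < rho ->
  let c := phi i \o g in
  `|derive1 c 0| <= r ->
  dom i (g 1) /\ `|c 1 - c 0 - derive1 c 0| <= 4 * K * r ^+ 2.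
Proof.
move=> K0 rho0 rhoP a b r g a0 b1 gg g0 g0x r0 Kr rrho c c'r.
set v := derive1 c 0 in c'r *.
pose C := psi i @` [set y | `|y - x| <= rho].
have B0 : 0 <= 4 * K * r ^+ 2 by rewrite !mulr_ge0 ?exprn_ge0 ?ltW.
have cC : closed C by apply: closed_chart_ball => // y /rhoP[].
have CP z : C z <-> dom i z /\ `|phi i z - x| <= rho.
  split=> [[y /= yrho <-]|[iz zrho]]; last by exists (phi i z); rewrite ?phiK.
  by have [[w iw wy] _] := rhoP _ yrho; rewrite -wy phiK// wy.
have jab t : 0 <= t <= 1 -> a < t < b.
  by move=> /andP[t0 t1]; rewrite (lt_le_trans a0 t0) (le_lt_trans t1 b1).
pose P t := C (g t) /\ `|derive1 c t| <= 2 * r.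
have chart t : 0 <= t <= 1 -> dom i (g t) -> _ :=
  fun t01 => geodesic_chart gg (jab t t01).
(* The two integrations: the geodesic equation bounds the acceleration by [K * (2 * r) ^+ 2], which
   controls the velocity, and the speed bound [2 * r] controls the position. *)
have est t : 0 <= t <= 1 -> (forall s, 0 <= s <= t -> P s) ->
    `|derive1 c t - v| <= 4 * K * r ^+ 2 * t /\ `|c t - c 0| <= 2 * r * t.
  move=> /andP[t0 t1] Ps.
  have s01 s : 0 <= s <= t -> 0 <= s <= 1.
    by move=> /andP[-> /le_trans]; exact.
  split; rewrite -[X in _ * X]subr0.
    apply: (@mean_value_le R 1 m (derive1 c) (derive1 (derive1 c)) 0 t _ t0) => s st.
      by have [/CP[gs _] _] := Ps s st; have [] := chart s (s01 _ st) gs.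
    have [/CP[gs gsx] c's] := Ps s st.
    have Js : `]a, b[%classic s by rewrite /= in_itv/=; exact/jab/s01.
    have /= := gg.2 i s Js gs; rewrite -/c => /eqP; rewrite addr_eq0 => /eqP ->.
    have [_ /(_ (derive1 c s)) H] := rhoP _ gsx.
    rewrite normrN (le_trans H)//.
    have -> : 4 * K * r ^+ 2 = K * (2 * r) ^+ 2 by ring.
    apply: (ler_wpM2l (ltW K0)); rewrite !expr2.
    by apply: ler_pM.
  apply: (@mean_value_le R 1 m c (derive1 c) 0 t _ t0) => s st.
    by have [/CP[gs _] _] := Ps s st; have [] := chart s (s01 _ st) gs.
  by have [] := Ps s st.
have P01 : forall t, 0 <= t <= 1 -> P t.
  apply: real_induction.
  - split; last by rewrite -/v; lra.
    by apply/CP; split=> //; lra.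
  - move=> t /andP[t0 t1] Ps.
    have t01 : 0 <= t <= 1 by rewrite (ltW t0).
    have tab := jab t t01.
    have Ct : C (g t).
      apply: closed_left_limit => //; last by move=> s /Ps[].
      by apply: gg.1.1; rewrite /= in_itv.
    split=> //; have /CP[gt _] := Ct.
    have [_ _ [/derivable1_diffP/differentiable_continuous c't _]] :=
      chart t t01 gt.
    have nc't : {for t, continuous (fun s => `|derive1 c s|)}.
      exact: cvg_norm.
    have cl : closed [set y : R | y <= 2 * r] by exact: closed_le.
    by apply: (closed_left_limit cl nc't t0) => s /Ps[].
  - move=> t /andP[t0 t1] Ps.
    have t01 : 0 <= t <= 1 by rewrite t0 ltW.
    have tt : 0 <= t <= t by rewrite t0 lexx.
    have [/CP[gt gtx] _] := Ps t tt.
    have [c't ct] := est t t01 Ps.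
    have [nt [/derivable1_diffP/differentiable_continuous cct _]
      [/derivable1_diffP/differentiable_continuous cc't _]] := chart t t01 gt.
    (* Strictness: [4 * K * r < 1] keeps the change of velocity below [r], and [4 * r < rho] keeps
       the change of position below [rho / 2]. *)
    have c'lt : `|derive1 c t| < 2 * r.
      rewrite -[derive1 c t](subrK v) (le_lt_trans (ler_normD _ _))//.
      have : 4 * K * r ^+ 2 * t <= 4 * K * r ^+ 2 by rewrite ler_piMr// ltW.
      have : 4 * K * r ^+ 2 < r by nra.
      lra.
    have clt : `|c t - x| < rho.
      rewrite -(subrKA (c 0)); apply: le_lt_trans (ler_normD _ _) _.
      have r2t : 2 * r * t <= 2 * r by rewrite ler_piMr ?mulr_ge0 ?ltW.
      apply: lt_le_trans (ler_ltD (le_trans ct r2t) g0x) _.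
      by clear -rrho; lra.
    have n1 : \forall s \near t, `|derive1 c s| < 2 * r.
      have cn : {for t, continuous (fun s => `|derive1 c s|)} by exact: cvg_norm.
      exact: (cvgr_lt _ cn _ c'lt).
    have n2 : \forall s \near t, `|c s - x| < rho.
      have cn : {for t, continuous (fun s => `|c s - x|)}.
        by apply: cvg_norm; apply: cvgB => //; exact: cvg_cst.
      exact: (cvgr_lt _ cn _ clt).
    apply: filterS3 nt n1 n2 => s [_ gs] /ltW c's /ltW cs.
    by split=> //; apply/CP.
have one01 : (0 : R) <= (1 : R) <= 1 by rewrite ler01 lexx.
have [/CP[g1 _] _] := P01 1 one01.
split=> //; rewrite addrAC.
have -> : c 1 - v - c 0 = (c 1 - 1 *: v) - (c 0 - 0 *: v).
  by rewrite scale1r scale0r subr0.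
rewrite -[leRHS]mulr1 -[X in _ * X]subr0.
apply: (@mean_value_le R 1 m (fun s => c s - s *: v) (fun s => derive1 c s - v) 0 1).
- exact: ler01.
- move=> s s01; have [/CP[gs _] _] := P01 s s01.
  have [_ cs _] := chart s s01 gs.
  have [dl el] : is_diff s (fun t : R => t *: v) (fun t => t *: v).
    exact: is_diff_scalel.
  have vs : is_derive s 1 (fun t : R => t *: v) v.
    apply: DeriveDef; first exact: diff_derivable.
    by rewrite deriveE// el scale1r.
  exact: is_deriveB.
- move=> s /[dup] s01 /andP[s0 s1].
  have [|+ _] := est s s01; last first.
    by move/le_trans; apply; rewrite ler_piMr.
  by move=> u /andP[u0 us]; apply: P01; rewrite u0 (le_trans us s1).
Qed.
End GeodesicEstimate.

(** * The exponential relation in a fixed chart *)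

Section Exponential.
Context {R : realType} {m : nat} {M : manifold R m} (D : connection M).

HB.instance Definition _ (i : mchart M) (xi : M) :=
  GRing.Linear.copy (@components R m M i xi)
    ('d (phi i \o psi (chart_at xi)) (phi (chart_at xi) xi)).

HB.instance Definition _ (i : mchart M) (xi : M) :=
  GRing.Linear.copy (@of_components R m M i xi)
    ('d (phi (chart_at xi) \o psi i) (phi i xi)).

(** [exp_rel] prescribes the initial velocity in the preferred chart of the starting point, whereas
    the estimates use one chart for all nearby points; the chain rule through the transition map
    converts. *)
Lemma geodesic_velocity (a b : R) (g : R -> M) (i : mchart M) :
  a < 0 -> 0 < b -> geodesic D `]a, b[ g -> dom i (g 0) ->
  derive1 (phi i \o g) 0 =
  components i (derive1 (phi (chart_at (g 0)) \o g) 0 : tangent (g 0)).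
Proof.
move=> a0 b0 gg gi; have ab0 : a < 0 < b by rewrite a0.
have gx := dom_chart_at (g 0); set c := chart_at (g 0) in gx *.
have [_ [/derivable1_diffP dc _] _] := geodesic_chart gg ab0 gx.
pose A := `]a, b[%classic `&` g @^-1` dom c.
have oA : open A by apply: open_preimage_on => //; [exact: dom_open|exact: gg.1.1].
have A0 : A 0 by split=> //; rewrite /= in_itv.
have e z : A z -> (phi i \o psi c) ((phi c \o g) z) = (phi i \o g) z.
  by move=> [_ /= cz]; rewrite phiK.
have e0 : (phi c \o g) 0 = phi c (g 0) by [].
have dt := transition_differentiable gx gi.
have [dh dhE] := diff_comp_eq oA A0 e e0 dc dt.
by rewrite (derive1E' dh) dhE (derive1E' dc).
Qed.

Lemma exp_rel_approx (i : mchart M) x : (phi i @` dom i) x ->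
  exists2 K : R, 0 < K & exists2 r : R, 0 < r &
    forall (zeta : M) (v : tangent zeta) (zeta' : M) (s : R),
      dom i zeta -> `|phi i zeta - x| < r -> 0 < s -> s < r ->
      `|components i v| <= s -> exp_rel D v zeta' ->
      dom i zeta' /\ `|phi i zeta' - phi i zeta - components i v| <= K * s ^+ 2.
Proof.
move=> ix; have [K K0 [rho rho0 rhoP]] := christoffel_bound D ix.
have k0 : 0 < (4 * K)^-1 by rewrite invr_gt0 mulr_gt0.
exists (4 * K); first by rewrite mulr_gt0.
(* The two bounds give the conditions [4 * s < rho] and [4 * K * s < 1] of [geodesic_estimate]. *)
exists (Num.min (rho / 4) (4 * K)^-1).
  by rewrite lt_min k0 andbT divr_gt0.
move=> zeta v zeta' s iz; rewrite !lt_min => /andP[zr _] s0 /andP[sr sk] vs.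
move=> [a [b [g [[a0 b1 gg] [g0 g'0 g1]]]]].
have Ks : 4 * K * s < 1 by rewrite -ltr_pdivlMl ?mulr_gt0// mulr1.
have sr' : 4 * s < rho by clear -sr; lra.
have gi0 : dom i (g 0) by rewrite g0.
have b0 : 0 < b by exact: lt_trans b1.
have vel := geodesic_velocity a0 b0 gg gi0.
have vE : derive1 (phi i \o g) 0 = components i v.
  by rewrite vel -g'0 -g0.
have gx : `|phi i (g 0) - x| < rho / 2.
  by rewrite g0; apply: lt_le_trans zr _; clear -rho0; lra.
have c's : `|derive1 (phi i \o g) 0| <= s by rewrite vE.
have := geodesic_estimate K0 rho0 rhoP a0 b1 gg gi0 gx s0 Ks sr' c's.
by rewrite /= vE g0 g1.
Qed.
End Exponential.

(** * Normal coordinates *)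

Lemma le_sqr_right {R : realType} (K s r X : R) : s < r ->
  (forall s', s < s' -> s' < r -> X <= K * s' ^+ 2) -> X <= K * s ^+ 2.
Proof.
move=> sr H; apply/ler_addgt0Pr => e e0.
have ct : {for s, continuous (fun t : R => K * t ^+ 2)}.
  by move=> t; apply: cvgM; [exact: cvg_cst|exact: exprn_continuous].
have lt : K * s ^+ 2 < K * s ^+ 2 + e by rewrite ltrDl.
have /near_norm_ball[d d0 dP] : \forall t \near s, K * t ^+ 2 < K * s ^+ 2 + e.
  exact: cvgr_lt _ ct _ lt.
pose t := s + Num.min d (r - s) / 2.
have m0 : 0 < Num.min d (r - s) by rewrite lt_min d0 subr_gt0.
have md : Num.min d (r - s) <= d by rewrite ge_min lexx.
have mr : Num.min d (r - s) <= r - s by rewrite ge_min lexx orbT.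
have st : s < t by rewrite /t; clear -m0; lra.
have tr : t < r by rewrite /t; clear -m0 mr; lra.
apply: (le_trans (H t st tr)); apply/ltW/dP.
by rewrite ger0_norm ?subr_ge0 1?ltW//; rewrite /t; clear -m0 md; lra.
Qed.

Section NormalCoordinates.
Context {R : realType} {m : nat} {M : manifold R m} {D : connection M}.

(* [exp_rel_approx] bootstraps with a strictly positive speed bound; letting it
   decrease to [s] covers [s = 0], i.e. the constant geodesic. *)
Lemma exp_rel_quadratic (i : mchart M) x : (phi i @` dom i) x ->
  exists2 K : R, 0 < K & exists2 r : R, 0 < r &
    forall (zeta : M) (v : tangent zeta) (zeta' : M) (s : R),
      dom i zeta -> `|phi i zeta - x| < r -> s < r ->
      `|components i v| <= s -> exp_rel D v zeta' ->
      dom i zeta' /\ `|phi i zeta' - phi i zeta - components i v| <= K * s ^+ 2.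
Proof.
move=> ix; have [K K0 [r r0 H]] := exp_rel_approx D ix.
exists K => //; exists r => // zeta v zeta' s iz zr sr vs ev.
have s0 : 0 <= s by exact: le_trans vs.
have H' s' : s < s' -> s' < r -> dom i zeta' /\
    `|phi i zeta' - phi i zeta - components i v| <= K * s' ^+ 2.
  move=> ss sr'; apply: H => //; first exact: le_lt_trans ss.
  exact: le_trans (ltW ss).
split; last by apply: (le_sqr_right sr) => s' ss /(H' s' ss)[].
have ss : s < (s + r) / 2 by clear -sr; lra.
have [] // := H' _ ss; by clear -sr; lra.
Qed.

Variable N : normal_coordinates D.
Implicit Types (xi zeta : M).

(* [Defs.iota] is qualified because [seq.iota] shadows it. *)
Lemma iota_inv_linear xi : linear (iota_inv N xi : 'rV[R]_m -> 'rV[R]_m).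
Proof.
move=> a u v; apply: (can_inj (@iotaK _ _ _ _ N xi)).
by rewrite linearP !iota_invK.
Qed.

HB.instance Definition _ xi := GRing.isLinear.Build R 'rV[R]_m 'rV[R]_m *:%R
  (iota_inv N xi : 'rV[R]_m -> 'rV[R]_m) (@iota_inv_linear xi).

Lemma ExpP xi (v : tangent xi) : nc_dom N xi v -> exp_rel D v (Exp D v).
Proof.
have [_ _ [Wd _ _ _ _] _] := nc_domP N xi => /Wd [zeta e].
by apply: (xgetPex xi); exists zeta.
Qed.

(** [Exp] chooses some endpoint of a geodesic with the given velocity; for velocity zero, the
    quadratic estimate with [s = 0] forces every such endpoint to be [xi]. *)
Lemma Exp0 xi : Exp D (0 : tangent xi) = xi.
Proof.
have [_ W0 _ _] := nc_domP N xi.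
have ix := dom_chart_at xi; set i := chart_at xi in ix.
have xim : (phi i @` dom i) (phi i xi) by exists xi.
have [K K0 [r r0 H]] := exp_rel_quadratic xim.
have c0 : components i (0 : tangent xi) = 0 by rewrite linear0.
have [||i' +] := H xi 0 (Exp D (0 : tangent xi)) 0 ix _ r0 _ (ExpP W0).
- by rewrite subrr normr0.
- by rewrite c0 normr0.
rewrite c0 subr0 expr0n mulr0 normr_le0 subr_eq0 => /eqP e.
by rewrite -(phiK i') e phiK.
Qed.

Lemma theta_inv0 xi : theta_inv N xi 0 = xi.
Proof. by rewrite /theta_inv linear0 Exp0. Qed.

Lemma Exp_invP xi zeta : normal_nbhd N xi zeta ->
  nc_dom N xi (Exp_inv D (nc_dom N xi) zeta) /\
  Exp D (Exp_inv D (nc_dom N xi) zeta) = zeta.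
Proof.
move=> [v Wv e].
exact: (@xgetPex _ 0 [set v | nc_dom N xi v /\ Exp D v = zeta]
  (ex_intro _ v (conj Wv e))).
Qed.

Lemma thetaK xi zeta : normal_nbhd N xi zeta ->
  theta_inv N xi (theta N xi zeta) = zeta.
Proof. by move=> /Exp_invP[_]; rewrite /theta_inv /theta iotaK. Qed.

Lemma theta_image xi zeta : normal_nbhd N xi zeta ->
  normal_image N xi (theta N xi zeta).
Proof. by move=> /Exp_invP[W _]; exists (Exp_inv D (nc_dom N xi) zeta). Qed.

Lemma theta_inv_rel xi u : normal_image N xi u ->
  exp_rel D (iota_inv N xi u) (theta_inv N xi u).
Proof. by move=> [v Wv <-]; rewrite /theta_inv iotaK; exact: ExpP. Qed.

Lemma normal_nbhd_self xi : normal_nbhd N xi xi.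
Proof. by have [_ W0 _ _] := nc_domP N xi; exists 0 => //; exact: Exp0. Qed.

Lemma normal_nbhd_open xi : open (normal_nbhd N xi).
Proof. by have [_ _ [] ] := nc_domP N xi. Qed.

Lemma theta_self xi : theta N xi xi = 0.
Proof.
have [_ W0 [_ inj _ _ _] _] := nc_domP N xi.
have [W e] := Exp_invP (normal_nbhd_self xi).
have v0 : Exp_inv D (nc_dom N xi) xi = 0 by apply: inj; rewrite ?inE// e Exp0.
by rewrite /theta v0 linear0.
Qed.

Lemma theta_smooth xi (i : mchart M) k :
  class_C k (phi i @` (normal_nbhd N xi `&` dom i)) (theta N xi \o psi i).
Proof.
have [_ _ [_ _ _ _ sm] _] := nc_domP N xi.
have oA := phi_image_open (i := i) (normal_nbhd_open xi).
exact: (class_C_linear (@linear_rV_continuous R _ m (Defs.iota N xi)) oA (sm i k)).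
Qed.

Lemma normal_image_near xi :
  \forall u \near (0 : 'rV[R]_m), normal_image N xi u.
Proof.
have [oW W0 _ _] := nc_domP N xi.
have c0 := @linear_rV_continuous R _ m (iota_inv N xi : {linear _ -> _}) (0 : 'rV[R]_m).
have W0' : nbhs (iota_inv N xi 0 : 'rV[R]_m) (nc_dom N xi).
  by rewrite linear0; exact: open_nbhs_nbhs.
have H : \forall u \near (0 : 'rV[R]_m), nc_dom N xi (iota_inv N xi u) := c0 _ W0'.
by apply: filterS H => u Wu; exists (iota_inv N xi u); rewrite ?iota_invK.
Qed.

(** The exponential map has the identity as differential at 0: [exp_rel_quadratic] at [zeta = xi],
    with [s] proportional to the norm of [u], leaves a remainder quadratic in [u]. *)
Lemma theta_inv_diff xi (i : mchart M) : dom i xi ->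
  forall u, 'd (phi i \o theta_inv N xi) 0 u = components i (iota_inv N xi u).
Proof.
move=> ix.
have xim : (phi i @` dom i) (phi i xi) by exists xi.
have [K K0 [r r0 H]] := exp_rel_quadratic xim.
pose l : {linear 'rV[R]_m -> 'rV[R]_m} := @components R m M i xi \o iota_inv N xi.
have [c c0 lc] := linear_rV_bound l.
have [_ e] : is_diff (0 : 'rV[R]_m) (phi i \o theta_inv N xi) l.
  apply: (@quadratic_diff _ _ _ _ _ _ (K * c ^+ 2)).
    exact: linear_rV_continuous.
  have rc : 0 < r / c by rewrite divr_gt0.
  have n : \forall u \near (0 : 'rV[R]_m), `|u| < r / c.
    by apply: (norm_ball_near rc) => u; rewrite subr0.
  apply: filterS2 (normal_image_near xi) n => u /theta_inv_rel ru uc.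
  rewrite addr0 /= theta_inv0 -mulrA -exprMn.
  have [] // := H xi (iota_inv N xi u) _ (c * `|u|) ix _ _ (lc u) ru.
    by rewrite subrr normr0.
  by rewrite mulrC -ltr_pdivlMr.
by move=> u; rewrite e.
Qed.

(** [exp_rel_quadratic] followed by [taylor_perturbation], uniformly in the starting point [zeta].
    It serves both to compute [J2_inv] and to expand the noise step. *)
Lemma theta_exp xi (i : mchart M) x :
  (phi i @` (normal_nbhd N xi `&` dom i)) x ->
  exists2 K : R, 0 < K & exists2 r : R, 0 < r &
    forall zeta (v : tangent zeta) (zeta' : M) (s : R),
      dom i zeta -> `|phi i zeta - x| < r -> s < r ->
      `|components i v| <= s -> exp_rel D v zeta' ->
      `|theta N xi zeta' - theta N xi zeta
        - 'd (theta N xi \o psi i) (phi i zeta) (components i v)| <= K * s ^+ 2.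
Proof.
move=> Ax; have xim : (phi i @` dom i) x.
  by have [z [_ iz] <-] := Ax; exists z.
have [C C0 [r1 r10 H1]] := exp_rel_quadratic xim.
have oA := phi_image_open (i := i) (normal_nbhd_open xi).
have [K K0 [r2 r20 H2]] := taylor_perturbation oA Ax (theta_smooth xi i 2) (ltW C0).
exists K => //; exists (Num.min r1 r2); first by rewrite lt_min r10.
move=> zeta v zeta' s iz; rewrite !lt_min => /andP[zr1 zr2] /andP[sr1 sr2] vs ev.
have [iz' ez'] := H1 zeta v zeta' s iz zr1 sr1 vs ev.
have [_ _] := H2 _ _ _ _ zr2 sr2 vs ez'.
by rewrite /= !phiK.
Qed.

(** Along the velocities given by [t *: w] the remainder of [theta_exp] is quadratic in [t], so the
    derivative at 0 is its linear term. *)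
Lemma J2_invE xi zeta (i : mchart M) w : normal_nbhd N xi zeta -> dom i zeta ->
  J2_inv N xi zeta w =
  'd (theta N xi \o psi i) (phi i zeta) (components i (iota_inv N zeta w)).
Proof.
move=> nz iz.
have Ax : (phi i @` (normal_nbhd N xi `&` dom i)) (phi i zeta) by exists zeta.
have [K K0 [r r0 H]] := theta_exp Ax.
set v := components i _; apply: (@quadratic_derive1 _ _ _ _ (K * `|v| ^+ 2)).
rewrite scale0r theta_inv0.
have n1 : \forall t \near (0 : R), normal_image N zeta (t *: w).
  have := @scalel_continuous _ _ w (0 : R); rewrite /continuous_at scale0r.
  by apply; exact: normal_image_near.
(* Adding 1 keeps the divisor positive when [v = 0]. *)
have v0 : 0 < `|v| + 1 by rewrite ltr_wpDl.
have rv : 0 < r / (`|v| + 1) by rewrite divr_gt0.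
have n2 : \forall t \near (0 : R), `|t| < r / (`|v| + 1).
  by apply: (norm_ball_near rv) => t; rewrite subr0.
apply: filterS2 n1 n2 => t /theta_inv_rel rt tr.
have vt : components i (iota_inv N zeta (t *: w)) = t *: v by rewrite !linearZ.
have := H zeta (iota_inv N zeta (t *: w)) _ (`|t| * `|v|) iz _ _ _ rt.
rewrite vt linearZ -mulrA -exprMn [`|v| * _]mulrC; apply.
- by rewrite subrr normr0.
- have : `|t| * (`|v| + 1) < r by rewrite -ltr_pdivlMr.
  by apply: le_lt_trans; rewrite ler_wpM2l// lerDl.
- by rewrite normrZ.
Qed.

End NormalCoordinates.

(** * Uniform bounds for the inverse of iota, and the system function in charts *)

Section LocalBounds.
Context {R : realType} {m : nat} {M : manifold R m} {D : connection M}.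
Variable N : normal_coordinates D.

(** The smoothness assumption controls [iota] read in the chart, called [B], while a uniform bound
    on its inverse is wanted. Writing [w = l0 (B xi0 w)] and [B xi0 w = u - (B zeta w - B xi0 w)],
    with [B zeta] close to [B xi0], bounds the norm of [w] by [K0] times that of [u] plus half of
    itself, which is absorbed. *)
Lemma iota_components_bound (xi0 : M) (i : mchart M) :
  iota_locally_smooth N xi0 -> dom i xi0 ->
  exists2 K : R, 0 < K & exists2 r : R, 0 < r &
    forall zeta, dom i zeta -> `|phi i zeta - phi i xi0| < r ->
      forall u, `|components i (iota_inv N zeta u)| <= K * `|u|.
Proof.
move=> [V [oV Vx sm]] ix.
pose B (zeta : M) w := Defs.iota N zeta (of_components i zeta w).
pose l0 : {linear 'rV[R]_m -> 'rV[R]_m} :=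
  @components R m M i xi0 \o iota_inv N xi0.
have [K0 K00 l0K] := linear_rV_bound l0.
pose e (a : 'I_m) : 'rV[R]_m := delta_mx 0 a.
have m0 : 0 < (m%:R + 1 : R) by rewrite ltr_wpDl.
(* Chosen so that [K0 * eta * m%:R <= 1 / 2]; the divisor [m%:R + 1] is nonzero even for [m = 0]. *)
pose eta := (2 * K0 * (m%:R + 1))^-1.
have eta0 : 0 < eta by rewrite invr_gt0 !mulr_gt0.
have Ax : (phi i @` (V `&` dom i `&` dom i)) (phi i xi0) by exists xi0.
have He (a : 'I_m) : \forall y \near phi i xi0,
    `|B (psi i y) (e a) - B xi0 (e a)| <= eta.
  have c : {for phi i xi0, continuous (fun y => B (psi i y) (e a))} :=
    sm i (e a) i 0%N _ Ax.
  have E : B (psi i (phi i xi0)) (e a) = B xi0 (e a) by rewrite phiK.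
  rewrite -E.
  exact: (@cvgrPdistC_le _ _ _ (nbhs (phi i xi0)) _ _ _).1 c eta eta0.
have /near_norm_ball[r r0 rP] : \forall y \near phi i xi0, forall a : 'I_m,
    `|B (psi i y) (e a) - B xi0 (e a)| <= eta.
  exact: filter_forall (nbhs_filter _) He.
exists (2 * K0); first by rewrite mulr_gt0.
exists r => // zeta iz zr u; set w := components i _.
have Bw : B zeta w = u by rewrite /B /w componentsK// iota_invK.
have B0w : l0 (B xi0 w) = w by rewrite /= /B iotaK of_componentsK.
have Hd : `|B zeta w - B xi0 w| <= eta * m%:R * `|w|.
  pose lB z : {linear 'rV[R]_m -> 'rV[R]_m} :=
    Defs.iota N z \o @of_components R m M i z.
  rewrite [X in `|X - _| <= _](linear_rV_sum (lB zeta) w).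
  rewrite [X in `|_ - X| <= _](linear_rV_sum (lB xi0) w) -sumrB.
  apply: le_trans (ler_norm_sum _ _ _) _.
  apply: (@le_trans _ _ (\sum_(a < m) eta * `|w|)); last first.
    by rewrite sumr_const card_ord -[leLHS]mulr_natr mulrAC.
  apply: ler_sum => a _; rewrite -scalerBr normrZ [leLHS]mulrC.
  apply: ler_pM => //; last exact: mx_coord_le.
  by have := rP _ zr a; rewrite phiK.
have H1 : `|w| <= K0 * (`|u| + eta * m%:R * `|w|).
  rewrite -{1}B0w; apply: le_trans (l0K _) _; apply: ler_wpM2l; first exact: ltW.
  rewrite -[B xi0 w](subKr (B zeta w)); apply: le_trans (ler_normB _ _) _.
  by rewrite Bw in Hd *; exact: lerD.
have H2 : K0 * (eta * m%:R * `|w|) <= `|w| / 2.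
  have -> : K0 * (eta * m%:R * `|w|) = (m%:R / (m%:R + 1)) * (`|w| / 2).
    by rewrite /eta; field; rewrite gt_eqF//= gt_eqF.
  apply: ler_piMl; first by rewrite divr_ge0.
  by rewrite ler_pdivrMr// mul1r lerDl.
rewrite mulrDr in H1; have := le_trans H1 (lerD (lexx _) H2).
by clear; lra.
Qed.

Lemma system_chart_smooth {L : normedModType R} (F : M * L -> M) (u : L)
    (i j : mchart M) : smooth_system F ->
  open [set y | (phi i @` dom i) y /\ dom j (F (psi i y, u))] /\
  forall k, class_C k [set y | (phi i @` dom i) y /\ dom j (F (psi i y, u))]
    (fun y => phi j (F (psi i y, u))).
Proof.
move=> [cF sF].
pose S := [set p : 'rV[R]_m * L | (phi i @` dom i) p.1 /\ dom j (F (psi i p.1, p.2))].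
have oS : open S.
  have -> : S = (fst @^-1` (phi i @` dom i)) `&`
      (fun p : 'rV[R]_m * L => F (psi i p.1, p.2)) @^-1` dom j by [].
  have ofst : open ((fst : 'rV[R]_m * L -> _) @^-1` (phi i @` dom i)).
    by apply: open_comp; [move=> p _; exact: cvg_fst|exact: image_open].
  apply: open_preimage_on => //; first exact: dom_open.
  move=> p ip; apply: (@continuous_comp _ _ _ (fun p => (psi i p.1, p.2)) F).
    apply: cvg_pair; last exact: cvg_snd.
    apply: (@continuous_comp _ _ _ fst (psi i)); first exact: cvg_fst.
    exact: psi_continuous.
  exact: cF.
split.
  rewrite -[X in open X]setTI.
  apply: (open_preimage_on (f := fun y : 'rV[R]_m => (y, u)) openT oS).
  move=> y _; apply: differentiable_continuous.
  by have [] := is_diff_pair (is_diff_id y) (is_diff_cst u y).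
by move=> k; exact: (class_C_slice u oS (sF i j k)).
Qed.

End LocalBounds.

(** * The prediction error *)

Section Prediction.
Context {R : realType} {m : nat} {M : manifold R m} {D : connection M}.
Variable N : normal_coordinates D.
Context {L : normedModType R} (F : M * L -> M) (u : L).

Lemma linearised_map (xi0 : M) (eps : 'rV[R]_m) : let xi1 := F (xi0, u) in
  diff_from (theta N xi1) xi1
    (diff_self (fun xi => F (xi, u)) xi0 (diff_to (theta_inv N xi0) 0 eps)) =
  'd (theta N xi1 \o psi (chart_at xi1)) (phi (chart_at xi1) xi1)
    ('d (fun y => phi (chart_at xi1) (F (psi (chart_at xi0) y, u)))
      (phi (chart_at xi0) xi0) (iota_inv N xi0 eps)).
Proof.
move=> xi1; have ix := dom_chart_at xi0.
(* [diff_to] uses the preferred chart of [theta_inv N xi0 0], a point equal to [xi0] only by a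
   proof; hence the generalisation over [z] and the transport by [congr1]. *)
have e (z : M) : z = xi0 ->
    'd (phi (chart_at z) \o theta_inv N xi0) 0 eps = iota_inv N xi0 eps.
  move=> ->; refine (eq_trans (theta_inv_diff N ix eps) _).
  by rewrite /components; apply: transition_id.
exact: (congr1 (fun w => 'd (theta N xi1 \o psi (chart_at xi1))
  (phi (chart_at xi1) xi1)
    ('d (fun y => phi (chart_at xi1) (F (psi (chart_at xi0) y, u)))
      (phi (chart_at xi0) xi0) w)) (e _ (theta_inv0 N xi0))).
Qed.

(* [H1], [H2] and [H3] expand the exponential map at [xi0], then [F], then
   [theta N xi1]; [H4] and [H5] handle the noise step from [F (xi, u)]. *)
Lemma prediction_error (xi0 : M) (xi1 := F (xi0, u)) : smooth_system F ->
  iota_locally_smooth N xi1 ->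
  exists C delta : R, 0 < delta /\ forall (xi : M) (kappa : 'rV[R]_m),
    normal_nbhd N xi0 xi -> normal_nbhd N xi1 (F (xi, u)) ->
    normal_image N (F (xi, u)) kappa ->
    `|(theta N xi0 xi, kappa)| < delta ->
    `|theta N xi1 (theta_inv N (F (xi, u)) kappa) -
      (diff_from (theta N xi1) xi1
        (diff_self (fun xi => F (xi, u)) xi0
          (diff_to (theta_inv N xi0) 0 (theta N xi0 xi))) +
       J2_inv N xi1 (F (xi, u)) kappa)| <= C * `|(theta N xi0 xi, kappa)| ^+ 2.
Proof.
move=> sF siota.
have i0x := dom_chart_at xi0; set i0 := chart_at xi0 in i0x *.
have i1x := dom_chart_at xi1; set i1 := chart_at xi1 in i1x *.
pose y0 := phi i0 xi0; pose x1 := phi i1 xi1.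
pose h y := phi i1 (F (psi i0 y, u)).
have [oA2 sh] := system_chart_smooth u i0 i1 sF.
set A2 := [set y | _] in oA2 sh.
have y0im : (phi i0 @` dom i0) y0 by exists xi0.
have A2y0 : A2 y0 by split=> //; rewrite /y0 phiK.
have hy0 : h y0 = x1 by rewrite /h /y0 phiK.
have [K1 K10 [r1 r10 H1]] := exp_rel_quadratic (D := D) y0im.
(* Each expansion admits as error the remainder of the preceding one: [K1] here, then [K2] for
   [H3]. *)
have [K2 K20 [r2 r20 H2]] := taylor_perturbation oA2 A2y0 (sh 2) (ltW K10).
have oA3 := phi_image_open (i := i1) (normal_nbhd_open N xi1).
have A3x : (phi i1 @` (normal_nbhd N xi1 `&` dom i1)) x1.
  by exists xi1 => //; split=> //; exact: normal_nbhd_self.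
have [K3 K30 [r3 r30 H3]] :=
  taylor_perturbation oA3 A3x (theta_smooth N xi1 i1 2) (ltW K20).
have [K4 K40 [r4 r40 H4]] := theta_exp A3x.
have [K5 K50 [r5 r50 H5]] := iota_components_bound siota i1x.
have [k k0 H0] := linear_rV_bound (iota_inv N xi0 : {linear _ -> _}).
pose rho := Num.min 1 (Num.min (Num.min r1 r2) (Num.min r3 (Num.min r4 r5))).
have rho0 : 0 < rho by rewrite !lt_min ltr01 r10 r20 r30 r40 r50.
(* The summands are the factors of [n] bounding four vectors: the initial velocity [w1], its image
   [w2] under the differential of [h], the displacement of [F (xi, u)] from [xi1] in the chart, and
   the velocity of the noise. With [n < rho / T] each bound is below [rho]. *)
pose T := k + (K2 + 1) * k + 2 * K2 * k + K5.
have p1 : 0 < (K2 + 1) * k by rewrite mulr_gt0// addr_gt0.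
have p2 : 0 < 2 * K2 * k by rewrite !mulr_gt0.
have T0 : 0 < T by rewrite /T !addr_gt0.
(* The first term comes from [H3] at [s = (K2 + 1) * k * n], the second from [H4] at
   [s = K5 * n]. *)
exists (K3 * ((K2 + 1) * k) ^+ 2 + K4 * K5 ^+ 2), (rho / T).
split=> [|xi kappa nxi nxi1 ikappa]; first by rewrite divr_gt0.
set eps := theta N xi0 xi; set n := `|(eps, kappa)| => nd.
have en : `|eps| <= n by rewrite /n prod_normE le_max lexx.
have kn : `|kappa| <= n by rewrite /n prod_normE le_max lexx orbT.
have n0 : 0 <= n by exact: le_trans en.
have nT : T * n < rho by rewrite mulrC -ltr_pdivlMr.
have small c : c <= T -> [/\ c * n < 1, c * n < r1, c * n < r2, c * n < r3 &
    c * n < r4 /\ c * n < r5].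
  move=> cT; have : c * n < rho by exact: le_lt_trans (ler_wpM2r n0 cT) nT.
  by rewrite !lt_min => /and4P[-> /andP[-> ->] -> /andP[-> ->]].
have [s1_1 s1_r1 s1_r2 _ _] : [/\ k * n < 1, k * n < r1, k * n < r2, k * n < r3 &
    k * n < r4 /\ k * n < r5].
  by apply: small; rewrite /T; clear -p1 p2 K50; lra.
have [_ _ _ s2_r3 _] := small ((K2 + 1) * k)
  ltac:(by rewrite /T; clear -k0 p2 K50; lra).
have [_ _ _ _ [s4_r4 s4_r5]] := small (2 * K2 * k)
  ltac:(by rewrite /T; clear -k0 p1 K50; lra).
have [_ _ _ _ [s3_r4 _]] := small K5 ltac:(by rewrite /T; clear -k0 p1 p2; lra).
set w1 : 'rV[R]_m := iota_inv N xi0 eps.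
have w1s : `|w1| <= k * n.
  by apply: le_trans (H0 eps) _; apply: ler_wpM2l => //; exact: ltW.
have c1 : components i0 (w1 : tangent xi0) = w1 by exact: transition_id.
have exi := theta_inv_rel (theta_image nxi); rewrite thetaK// in exi.
have [ixi yq] : dom i0 xi /\ `|phi i0 xi - y0 - w1| <= K1 * (k * n) ^+ 2.
  by rewrite -{1}c1; apply: H1 => //; [rewrite subrr normr0|rewrite c1].
have y00 : `|y0 - y0| < r2 by rewrite subrr normr0.
have [[_ ixi1] w2s hq] := H2 _ _ _ _ y00 s1_r2 w1s yq.
set w2 := 'd _ y0 w1 in w2s hq.
rewrite /= phiK// in ixi1; rewrite -/(h _) -/(h _) hy0 in hq.
have hxi : h (phi i0 xi) = phi i1 (F (xi, u)) by rewrite /h phiK.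
(* Enlarging [s] from [k * n] to [(K2 + 1) * k * n] lets one [s] bound [w2] and keep the error below
   [K2 * s ^+ 2], as [H3] requires. *)
have w2s' : `|w2| <= (K2 + 1) * k * n.
  apply: le_trans w2s _; rewrite mulrA; apply: ler_wpM2r => //.
  by rewrite mulrDl lerDl mul1r ltW.
have hq' : `|h (phi i0 xi) - x1 - w2| <= K2 * ((K2 + 1) * k * n) ^+ 2.
  apply: le_trans hq _; apply: ler_wpM2l; first exact: ltW.
  rewrite -mulrA [leRHS]exprMn ler_peMl ?sqr_ge0//.
  by apply: exprn_ege1; rewrite lerDr ltW.
have x11 : `|x1 - x1| < r3 by rewrite subrr normr0.
have [_ _] := H3 _ _ _ _ x11 s2_r3 w2s' hq'.
rewrite hxi /= /x1 !phiK// theta_self subr0 => E1.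
(* This places [F (xi, u)] within the radii of [H4] and [H5]; [k * n < 1] turns the quadratic error
   into a linear one. *)
have dx : `|phi i1 (F (xi, u)) - x1| <= 2 * K2 * k * n.
  rewrite -hxi -(subrK w2 (h _ - x1)); apply: le_trans (ler_normD _ _) _.
  apply: le_trans (lerD hq w2s) _.
  have q : (k * n) ^+ 2 <= k * n.
    by rewrite expr2 ler_piMl// ?mulr_ge0// ltW.
  have := ler_wpM2l (ltW K20) q; clear; lra.
have dx4 := le_lt_trans dx s4_r4; have dx5 := le_lt_trans dx s4_r5.
have vs : `|components i1 (iota_inv N (F (xi, u)) kappa)| <= K5 * n.
  apply: le_trans (H5 _ ixi1 dx5 kappa) _.
  by apply: ler_wpM2l => //; exact: ltW.
have E2 := H4 _ _ _ _ ixi1 dx4 s3_r4 vs (theta_inv_rel ikappa).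
rewrite linearised_map (J2_invE kappa nxi1 ixi1).
have tri (X Y a b : 'rV[R]_m) (c d : R) : `|X - Y - a| <= c -> `|Y - b| <= d ->
    `|X - (b + a)| <= c + d.
  move=> Xc Yd; have -> : X - (b + a) = (X - Y - a) + (Y - b).
    by rewrite addrACA subrK -opprD [a + b]addrC.
  by apply: le_trans (ler_normD _ _) _; exact: lerD.
(* The noise step [E2] and the propagation step [E1] meet at [theta N xi1 (F (xi, u))]. *)
apply: le_trans (tri _ _ _ _ _ _ E2 E1) _.
by rewrite le_eqVlt; apply/orP; left; apply/eqP; ring.
Qed.
End Prediction.

Theorem lemma4p1 (R : realType) (m : nat) (M : manifold R m)
    (D : connection M) (N : normal_coordinates D)
    (L : normedModType R) (F : M * L -> M) (hF : smooth_system F)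
    (Q : 'M[R]_m) (hQ : positive_definite Q)
    (xihat : M) (u : L) (xihat1 : M) (hxihat1 : xihat1 = F (xihat, u))
    (hiota : iota_locally_smooth N xihat1) :
  let F_u := fun xi : M => F (xi, u) in
  let A := fun eps : 'rV[R]_m =>
    diff_from (theta N xihat1) xihat1
      (diff_self F_u xihat
        (diff_to (theta_inv N xihat) 0 eps)) in
  exists C delta : R, 0 < delta /\
    forall (xi : M) (d : measure_display) (T : measurableType d)
      (P : probability T R) (kappa : T -> 'rV[R]_m) (xi1 : T -> M),
      let xidiamond := F (xi, u) in
      concentrated_gaussian N xidiamond 0 Q P kappa ->
      (forall omega, xi1 omega = boxplus N xidiamond (kappa omega)) ->
      normal_nbhd N xihat xi ->
      normal_nbhd N xihat1 xidiamond ->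
      forall omega : T,
        normal_image N xidiamond (kappa omega) ->
        normal_nbhd N xihat1 (xi1 omega) ->
        let eps := boxminus N xi xihat in
        let eps1 := boxminus N (xi1 omega) xihat1 in
        `|(eps, kappa omega)| < delta ->
        `|eps1 - (A eps + J2_inv N xihat1 xidiamond (kappa omega))|
          <= C * `|(eps, kappa omega)| ^+ 2.
Proof.
move=> F_u A; rewrite {}hxihat1 in hiota A *.
(* These constants are fixed before the state and the noise are introduced; the bound then holds
   outcome by outcome. *)
have [C [delta [delta0 H]]] := prediction_error hF hiota.
exists C, delta; split=> // xi d T P kappa xi1 xidiamond _ xi1E nxi nxi1 omega.
by rewrite xi1E => ikappa _; exact: H.
Qed.
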